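(* Let $m,n$ be positive integers and let $\mathcal{A}\subseteq \mathcal{A}_m^n$ be a strongly transitive arrangement. Then the map $\overline{\Phi}_\mathcal{A}$ is a bijection from the set $\overline{\mathcal{T}}_m^n(\mathcal{A})$ of marked trees to the set of faces of $\mathcal{A}$. Moreover, for every $(T,\mu)\in\overline{\mathcal{T}}_m^n(\mathcal{A})$, the number $|\mu|$ of marked edges equals the codimension of the face $\overline{\Phi}_\mathcal{A}(T,\mu)$.
   Context: Notation: $\mathbb{N}=\{0,1,2,\ldots\}$; for integers $a,b$, $[a;b]=\{k\in\mathbb{Z}: a\le k\le b\}$ and $[n]=[1;n]$. For distinct $i,j\in[n]$ and $s\in\mathbb{Z}$, $\{x_i-x_j=s\}$ denotes the hyperplane $\{(x_1,\dots,x_n)\in\mathbb{R}^n : x_i-x_j=s\}$ (so $\{x_i-x_j=s\}=\{x_j-x_i=-s\}$). A braid-type arrangement in $\mathbb{R}^n$ is a finite set of such hyperplanes. The $m$-Catalan arrangement $\mathcal{A}_m^n$ is the set of all hyperplanes $\{x_i-x_j=s\}$ with $1\le i<j\le n$ and $s\in[-m;m]$. Let $\mathrm{Tr}_m^n$ be the set of triples $(i,j,s)$ with $i,j\in[n]$, $i\neq j$, $s\in[0;m]$ and ($s>0$ or $i>j$); every hyperplane of $\mathcal{A}_m^n$ equals $\{x_i-x_j=s\}$ for exactly one triple in $\mathrm{Tr}_m^n$. For $\mathcal{A}\subseteq\mathcal{A}_m^n$, $\mathrm{Tr}_m^n(\mathcal{A})$ is the set of triples $(i,j,s)\in \mathrm{Tr}_m^n$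 with $\{x_i-x_j=s\}\in\mathcal{A}$. A braid-type arrangement $\mathcal{A}$ in $\mathbb{R}^n$ is strongly transitive if for all distinct $i,j,k\in[n]$ and all integers $s,t\ge 0$: if $\{x_i-x_j=s\}\notin\mathcal{A}$ and $\{x_j-x_k=t\}\notin\mathcal{A}$, then $\{x_i-x_k=s+t\}\notin\mathcal{A}$. A face of a hyperplane arrangement is a nonempty set obtained by choosing, for each hyperplane $\{f=c\}$ of the arrangement, one of the conditions $f<c$, $f=c$, $f>c$, and intersecting the resulting sets; its codimension is $n$ minus the dimension of its affine span. An $(m,n)$-tree is a rooted plane tree in which every internal vertex (called a node) has exactly $m+1$ ordered children, called its $0$-child, $1$-child, ..., $m$-child, each child being a node or a leaf, with exactly $n$ nodes labeled bijectively by $[n]$ (leaves are unlabeled); nodes are identified with their labels. A node $i$ is the $s$-cadet of node $j$ if $i$ is the $s$-child of $j$ and the $t$-child of $j$ is a leaf for every $t\in[s+1;m]$; then $\{i,j\}$ is called a cadet edge. For a vertex $v$ (node or leaf) with root-to-$v$ path $v_0,v_1,\dots,v_k=v$, let $\mathrm{path}_T(v)=(s_1,\dots,s_k)$ where $v_i$ is the $s_i$-child of $v_{i-1}$, and $\mathrm{drift}_T(v)=\sum_{i=1}^k s_i$. The total order $\prec_T$ on all vertices of $T$ is: for distinct $v,w$ with $\mathrm{path}_T(v)=(s_1,\dots,s_k)$, $\mathrm{path}_T(w)=(t_1,\dots,t_\ell)$, $v\prec_T w$ iff $\mathrm{drift}_T(v)<\mathrm{drift}_T(w)$, or $\mathrm{drift}_T(v)=\mathrm{drift}_T(w)$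 and there is $j\le k$ with $(s_1,\dots,s_j)=(t_1,\dots,t_j)$ and ($j=k$ or $s_{j+1}>t_{j+1}$). Write $\preceq_T,\succeq_T$ for the associated non-strict relations. A marked $(m,n)$-tree is a pair $(T,\mu)$ where $T$ is an $(m,n)$-tree and $\mu$ is a set of cadet edges of $T$ such that whenever $\{j,i\}\in\mu$ with $i$ the $0$-cadet of $j$, we have $j<i$; edges in $\mu$ are called marked. $\overline{\mathcal{T}}_m^n$ denotes the set of marked $(m,n)$-trees. For nodes $i,j$ write $i\overset{\mu}{\sim}j$ if $i=j$ or all edges of the path of $T$ between $i$ and $j$ are in $\mu$; the equivalence classes are the blocks of $(T,\mu)$. For $\mathcal{A}\subseteq\mathcal{A}_m^n$: a block $B$ of $(T,\mu)$ is $\mathcal{A}$-connected if the graph with vertex set $B$ and edges $\{i,j\}$ ($i\ne j\in B$) such that $\{x_i-x_j=\mathrm{drift}_T(i)-\mathrm{drift}_T(j)\}\in\mathcal{A}$ is connected; $(T,\mu)$ is $\mathcal{A}$-connected if all its blocks are. $(T,\mu)$ satisfies the $\mathcal{A}$-cadet condition if every cadet edge $\{i,j\}\notin\mu$, with $i$ the $s$-cadet of $j$, satisfies ($s=0$ and $i<j$) or (there exist $i'\overset{\mu}{\sim}i$ and $j'\overset{\mu}{\sim}j$ with $\{x_{i'}-x_{j'}=\mathrm{drift}_T(i')-\mathrm{drift}_T(j')\}\in\mathcal{A}$). $\overline{\mathcal{T}}_m^n(\mathcal{A})$ is the set of marked trees in $\overline{\mathcal{T}}_m^n$ that are $\mathcal{A}$-connected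 and satisfy the $\mathcal{A}$-cadet condition. For $(T,\mu)\in\overline{\mathcal{T}}_m^n(\mathcal{A})$, $\overline{\Phi}_\mathcal{A}(T,\mu)=\Big(\bigcap_{\{i,j\}\in\mu,\ i=s\text{-child of }j}\{x_i-x_j=s\}\Big)\cap\Big(\bigcap_{(i,j,s)\in\mathrm{Tr}_m^n(\mathcal{A}),\ i\not\overset{\mu}{\sim}j,\ i\prec_T v_{j,s}}\{x_i-x_j<s\}\Big)\cap\Big(\bigcap_{(i,j,s)\in\mathrm{Tr}_m^n(\mathcal{A}),\ i\not\overset{\mu}{\sim}j,\ i\succeq_T v_{j,s}}\{x_i-x_j>s\}\Big)$, where $v_{j,s}$ denotes the $s$-child of $j$ (a node or a leaf). *)

(* Defs.v *)
From mathcomp Require Import all_boot all_order all_algebra.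
From mathcomp Require Import boolp classical_sets functions reals.

Set Implicit Arguments.
Unset Strict Implicit.
Unset Printing Implicit Defensive.

Import Order.TTheory GRing.Theory Num.Theory.
Local Open Scope classical_set_scope.
Local Open Scope ring_scope.

(* The index set [n] is 'I_n, i.e. {0, ..., n-1} instead of {1, ..., n}; only
   the order of the indices matters. *)

Section Arrangements.
Variables (R : realType) (n : nat).
Implicit Types (A : set (set 'rV[R]_n)) (F : set 'rV[R]_n).

Definition hyperplane (i j : 'I_n) (s : int) : set 'rV[R]_n :=
  [set x | x ord0 i - x ord0 j = s%:~R].

Definition catalan (m : nat) : set (set 'rV[R]_n) :=
  [set H | exists (i j : 'I_n) (s : int),
     [/\ (i < j)%N, - m%:Z <= s <= m%:Z & H = hyperplane i j s]].

Definition strongly_transitive A : Prop :=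
  forall (i j k : 'I_n) (s t : nat), i != j -> j != k -> i != k ->
    ~ A (hyperplane i j s%:Z) -> ~ A (hyperplane j k t%:Z) ->
    ~ A (hyperplane i k (s + t)%N%:Z).

Definition side (c : comparison) (a b : R) : Prop :=
  match c with Lt => a < b | Eq => a = b | Gt => a > b end.

(* Each hyperplane of a braid-type arrangement has exactly one equation
   x_i - x_j = s with i < j, so [e] chooses one condition per hyperplane. *)
Definition is_face A F : Prop :=
  F !=set0 /\
  exists e : 'I_n -> 'I_n -> int -> comparison,
    F = [set x | forall (i j : 'I_n) (s : int), (i < j)%N ->
           A (hyperplane i j s) ->
           side (e i j s) (x ord0 i - x ord0 j) s%:~R].

Definition affine_span F : set 'rV[R]_n :=
  [set x | exists (k : nat) (a : 'I_k -> R) (p : 'I_k -> 'rV[R]_n),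
     [/\ forall l, F (p l), \sum_(l < k) a l = 1 &
         x = \sum_(l < k) a l *: p l]].

Definition has_affine_dim F (d : nat) : Prop :=
  exists (p : 'rV[R]_n) (V : {vspace 'rV[R]_n}),
    affine_span F = [set x | x - p \in V] /\ \dim V = d.

Definition has_codim F (c : nat) : Prop :=
  exists2 d, has_affine_dim F d & c = (n - d)%N.

End Arrangements.

Section Trees.
Variables (m n : nat).

(* [Node i c] has label i and s-child [c s], for s in {0, ..., m}. *)
Inductive tree : Type :=
| Leaf
| Node of 'I_n & {ffun 'I_m.+1 -> tree}.

(* A vertex (node or leaf) is represented by its path from the root. *)
Definition vertex := seq 'I_m.+1.

Fixpoint subtree (t : tree) (v : vertex) : option tree :=
  match v, t with
  | [::], _ => Some t
  | s :: v', Node _ c => subtree (c s) v'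
  | _ :: _, Leaf => None
  end.

Fixpoint nodes (t : tree) : seq (vertex * 'I_n) :=
  match t with
  | Leaf => [::]
  | Node i c =>
      ([::], i) ::
      flatten [seq [seq (s :: q.1, q.2) | q <- nodes (c s)]
              | s <- enum 'I_m.+1]
  end.

Definition labels (t : tree) : seq 'I_n := [seq q.2 | q <- nodes t].

Definition is_mn_tree (t : tree) : bool := perm_eq (labels t) (enum 'I_n).

(* Meaningful when i labels exactly one node of t. *)
Definition node_path (t : tree) (i : 'I_n) : vertex :=
  nth [::] [seq q.1 | q <- nodes t] (index i (labels t)).

Definition child_vertex (t : tree) (j : 'I_n) (s : 'I_m.+1) : vertex :=
  rcons (node_path t j) s.

Definition is_child (t : tree) (i j : 'I_n) (s : 'I_m.+1) : bool :=
  node_path t i == child_vertex t j s.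

Definition is_cadet (t : tree) (i j : 'I_n) (s : 'I_m.+1) : Prop :=
  is_child t i j s /\
  forall u : 'I_m.+1, (s < u)%N -> subtree t (child_vertex t j u) = Some Leaf.

Definition vdrift (v : vertex) : nat := (\sum_(s <- v) s)%N.

Definition drift (t : tree) (i : 'I_n) : nat := vdrift (node_path t i).

(* The order on the vertices of a tree. When [take k v == take k w] holds with
   k <= size v, also k <= size w; the entry of index k is the (k+1)-st one. *)
Definition prec (v w : vertex) : bool :=
  (v != w) &&
  ((vdrift v < vdrift w)%N ||
   (vdrift v == vdrift w) &&
   [exists k : 'I_(size v).+1,
      (take k v == take k w) &&
      ((k == size v :> nat) ||
       [&& (k < size v)%N, (k < size w)%N &
           (nth ord0 w k < nth ord0 v k)%N])]).

Definition preceq (v w : vertex) : bool := (v == w) || prec v w.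

(* A set mu of edges between nodes; edges are unordered pairs of labels. *)
Definition edges := {set {set 'I_n}}.

Definition is_marked_tree (t : tree) (mu : edges) : Prop :=
  [/\ is_mn_tree t,
      forall e, e \in mu ->
        exists (i j : 'I_n) (s : 'I_m.+1),
          is_cadet t i j s /\ e = [set i; j]%SET &
      forall i j : 'I_n, is_cadet t i j ord0 -> [set j; i]%SET \in mu ->
        (j < i)%N].

Definition adjacent (t : tree) : rel 'I_n := fun i j =>
  [exists s, is_child t i j s || is_child t j i s].

(* The path of t between i and j is its only simple path i :: p ending at j. *)
Definition equiv (t : tree) (mu : edges) (i j : 'I_n) : Prop :=
  i = j \/
  exists p : seq 'I_n,
    [/\ path (adjacent t) i p, uniq (i :: p), last i p = j &
        path (fun a b => [set a; b]%SET \in mu) i p].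

Definition block (t : tree) (mu : edges) (i : 'I_n) : {set 'I_n} :=
  [set j | `[< equiv t mu i j >]]%SET.

Variable R : realType.
Variable A : set (set 'rV[R]_n).

Definition drift_hyperplane (t : tree) (i j : 'I_n) : set 'rV[R]_n :=
  hyperplane i j ((drift t i)%:Z - (drift t j)%:Z).

Definition connected_block (t : tree) (B : {set 'I_n}) : Prop :=
  {in B &, forall i j : 'I_n,
    connect (fun a b : 'I_n =>
      [&& a \in B, b \in B, a != b & `[< A (drift_hyperplane t a b) >]]) i j}.

Definition arr_connected (t : tree) (mu : edges) : Prop :=
  forall i : 'I_n, connected_block t (block t mu i).

Definition cadet_condition (t : tree) (mu : edges) : Prop :=
  forall (i j : 'I_n) (s : 'I_m.+1),
    is_cadet t i j s -> [set i; j]%SET \notin mu ->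
    (s = ord0 /\ (i < j)%N) \/
    exists i' j' : 'I_n, [/\ equiv t mu i' i, equiv t mu j' j &
                             A (drift_hyperplane t i' j')].

Definition marked_trees : set (tree * edges) :=
  [set T | [/\ is_marked_tree T.1 T.2, arr_connected T.1 T.2 &
               cadet_condition T.1 T.2]].

Definition triple (i j : 'I_n) (s : 'I_m.+1) : Prop :=
  [/\ i != j, (0 < s)%N || (j < i)%N & A (hyperplane i j (s : nat)%:Z)].

Definition Phi (T : tree * edges) : set 'rV[R]_n :=
  let: (t, mu) := T in
  [set x | forall (i j : 'I_n) (s : 'I_m.+1),
     [set i; j]%SET \in mu -> is_child t i j s ->
     x ord0 i - x ord0 j = (s : nat)%:R] `&`
  [set x | forall (i j : 'I_n) (s : 'I_m.+1),
     triple i j s -> ~ equiv t mu i j ->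
     prec (node_path t i) (child_vertex t j s) ->
     x ord0 i - x ord0 j < (s : nat)%:R] `&`
  [set x | forall (i j : 'I_n) (s : 'I_m.+1),
     triple i j s -> ~ equiv t mu i j ->
     preceq (child_vertex t j s) (node_path t i) ->
     x ord0 i - x ord0 j > (s : nat)%:R].

End Trees.

(* Main.v *)
(* To a marked tree attach the point with coordinates drift(i) + offset(i), where
   offset(i) sums delta^(drift k + 1) over the unmarked ancestors-or-self k of i
   and delta = 1/(n+1).  For nodes i, j in different blocks, i precedes the
   s-child of j exactly when this point satisfies x_i < x_j + s; inside a block
   offsets agree.  Hence Phi(T, mu) is the set of points having the same sign
   vector with respect to A as the point of (T, mu), a face whose equalities are
   generated by the marked edges.

   Injectivity: take two trees with the same face and the first vertex v (in the
   order of the trees) where they differ, say node i sits at v in T.  Strong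
   transitivity and the cadet condition force the ancestors of i in T', up to v,
   to be single-element blocks joined by unmarked 0-cadet edges with increasing
   labels, so that T' has at v a node larger than i; exchanging T and T' gives a
   contradiction.

   Surjectivity: a face contains a generic point (integer coordinate differences
   occur only inside blocks), and sorting the numbers x_j + s, s in [0;m], gives
   a marked tree whose point lies in the face.  If the cadet condition fails at
   an unmarked edge, the block of the child can be pushed just below the block of
   its parent without leaving the face, and this decreases the number of triples
   (i,j,s) with s > 0 or i > j, and x_i > x_j + s. *)

(* Offsets lie in [0, 1), so drift and offset are the integer and fractional parts of a coordinate
   of the tree point. A hyperplane [x_i - x_j = s] is then decided by the drifts unless these differ
   by exactly [s], and the offsets only have to reproduce the tie-breaking of the tree order. The
   value of delta makes their comparison lexicographic. Connectedness of the blocks lets the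
   equalities visible to [A] recover all marked edges. This is what carries blocks from one tree to
   another in the injectivity proof and what determines the direction space of a face in the
   codimension count. Surjectivity needs two perturbations. One makes coordinate differences between
   distinct classes non-integral while staying in the face. The other acts inside the classes too:
   sorting requires all numbers [x_j + s] to be distinct, and the ties have to be broken so that
   marked edges become cadet edges and marked 0-cadets get larger labels than their parents. *)
Require Import Defs.
From mathcomp Require Import all_boot all_order all_algebra.
From mathcomp Require Import boolp classical_sets functions reals.
From mathcomp Require Import ring lra zify.
Import Defs.
Set Implicit Arguments.
Unset Strict Implicit.
Unset Printing Implicit Defensive.
Import Order.TTheory GRing.Theory Num.Theory.
Local Open Scope classical_set_scope.
Local Open Scope ring_scope.

(** * Vertices and trees *)

Section VertexOrder.
Variable m : nat.
Implicit Types (v w p : vertex m) (s t : 'I_m.+1).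

(* The tie-breaking part of [prec]: a prefix comes first, and at a branching the
   larger child comes first. *)
Fixpoint plex v w : bool :=
  match v, w with
  | [::], _ => true
  | _ :: _, [::] => false
  | s :: v', t :: w' => (t < s)%N || (s == t) && plex v' w'
  end.

Lemma plex_refl v : plex v v.
Proof. by elim: v => //= s v ->; rewrite eqxx orbT. Qed.

Lemma plex_trans : transitive plex.
Proof.
elim=> [|s v IH] [|a u] [|b w] //= /orP[lt1|/andP[/eqP-> h1]] /orP[lt2|/andP[/eqP e2 h2]].
- by rewrite (ltn_trans lt2 lt1).
- by rewrite -e2 lt1.
- by rewrite lt2.
- by rewrite e2 eqxx (IH _ _ h1 h2) orbT.
Qed.

Lemma plex_anti : antisymmetric plex.
Proof.
elim=> [|s v IH] [|t w] //= /andP[/orP[l1|/andP[/eqP-> h1]] /orP[l2|/andP[/eqP e h2]]].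
- by have := ltn_trans l1 l2; rewrite ltnn.
- by move: l1; rewrite e ltnn.
- by move: l2; rewrite ltnn.
- by rewrite (IH w) // h1 h2.
Qed.

Lemma plex_total : total plex.
Proof.
elim=> [|s v IH] [|t w] //=.
case: (ltngtP s t) => [||/val_inj ->] //=; rewrite ?orbT //.
by rewrite !eqxx /= IH.
Qed.

Lemma vdrift_cons s v : vdrift (s :: v) = (s + vdrift v)%N.
Proof. by rewrite /vdrift big_cons. Qed.

Lemma vdrift_cat v w : vdrift (v ++ w) = (vdrift v + vdrift w)%N.
Proof. by rewrite /vdrift big_cat. Qed.

Lemma vdrift_rcons v s : vdrift (rcons v s) = (vdrift v + s)%N.
Proof. by rewrite -cats1 vdrift_cat /vdrift big_seq1. Qed.

Lemma vdrift_prefix v w : prefix v w -> (vdrift v <= vdrift w)%N.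
Proof. by case/prefixP => u ->; rewrite vdrift_cat leq_addr. Qed.

Lemma plexE v w :
  [exists k : 'I_(size v).+1,
      (take k v == take k w) &&
      ((k == size v :> nat) ||
       [&& (k < size v)%N, (k < size w)%N & (nth ord0 w k < nth ord0 v k)%N])]
  = plex v w.
Proof.
elim: v w => [|s v IH] w /=.
  by apply/fintype.existsP; exists ord0; rewrite /= take0 eqxx.
case: w => [|t w] /=.
  apply/negbTE/negP => /fintype.existsP[[k /= hk]] /andP[/eqP h]; case/orP => [/eqP e|].
    by move: h; rewrite e.
  by rewrite andbF.
case: eqP => [<-|/eqP neq] /=; last first.
  rewrite orbF; apply/fintype.existsP/idP => [[[[|k] /= hk]]|lts].
  - by [].
  - by case/andP => /eqP[e]; rewrite e eqxx in neq.
  - by exists ord0; rewrite /= lts.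
rewrite ltnn -IH; apply/fintype.existsP/fintype.existsP => [] [[k hk]] /=.
- case: k hk => [|k] hk /=.
    by rewrite ltnn.
  case/andP => /eqP[h1] h2; exists (Ordinal (hk : (k < (size v).+1)%N)) => /=.
  by rewrite h1 eqxx.
- by move=> h; exists (Ordinal (hk : (k.+1 < (size v).+2)%N)); rewrite /= eqseq_cons eqxx.
Qed.

Lemma precE v w : prec v w =
  (v != w) && ((vdrift v < vdrift w)%N || (vdrift v == vdrift w) && plex v w).
Proof. by rewrite /prec plexE. Qed.

Lemma preceqE v w : preceq v w =
  (vdrift v < vdrift w)%N || (vdrift v == vdrift w) && plex v w.
Proof.
rewrite /preceq precE; case: eqP => //= ->.
by rewrite eqxx plex_refl orbT.
Qed.

Lemma preceq_refl : reflexive (@preceq m).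
Proof. by move=> v; rewrite /preceq eqxx. Qed.

Lemma preceq_trans : transitive (@preceq m).
Proof.
move=> w v u; rewrite !preceqE => /orP[l1|/andP[/eqP-> h1]] /orP[l2|/andP[/eqP e h2]].
- by rewrite (ltn_trans l1 l2).
- by rewrite -e l1.
- by rewrite l2.
- by rewrite e eqxx (plex_trans h1 h2) orbT.
Qed.

Lemma preceq_total : total (@preceq m).
Proof.
move=> v w; rewrite !preceqE; case: ltngtP => //= _.
exact: plex_total.
Qed.

Lemma preceq_anti : antisymmetric (@preceq m).
Proof.
move=> v w; rewrite !preceqE; case: ltngtP => //= _ h; exact: plex_anti.
Qed.

Lemma precNge v w : prec v w = ~~ preceq w v.
Proof.
apply/idP/idP => [h|].
  apply/negP => h'; have e: v = w by apply: preceq_anti; rewrite h' /preceq h orbT.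
  by move: h; rewrite e precE eqxx.
by move=> h; case/orP: (preceq_total v w) h => [/orP[/eqP->|//]|->] //; rewrite preceq_refl.
Qed.

Lemma prec_trans : transitive (@prec m).
Proof.
move=> w v u h1 h2; rewrite precNge; apply/negP => h3.
move: h2; rewrite precNge => /negP; apply; apply: preceq_trans h3 _.
by rewrite /preceq h1 orbT.
Qed.

Lemma preceq_prec_trans w v u : preceq v w -> prec w u -> prec v u.
Proof. by case/orP => [/eqP->|h1 /(prec_trans h1)]. Qed.

Lemma prec_nil v : prec v [::] = false.
Proof.
have d0 : @vdrift m [::] = 0%N by rewrite /vdrift big_nil.
by rewrite precNge preceqE d0 /=; case: (vdrift v).
Qed.

Variant vertex_split_spec v w : Prop :=
| SplitPrefix of prefix v w
| SplitExt u v' of v = w ++ u :: v'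
| SplitDiv p s t v' w' of v = p ++ s :: v' & w = p ++ t :: w' & s != t.

Lemma vertex_splitP v w : vertex_split_spec v w.
Proof.
elim: v w => [|s v IH] w; first by apply: SplitPrefix; rewrite prefix0s.
case: w => [|t w]; first exact: (@SplitExt _ _ s v).
case: (eqVneq s t) => [<-|neq]; last exact: (@SplitDiv _ _ [::] s t v w).
case: (IH w) => [h|u v' ->|p a b v' w' -> -> h].
- by apply: SplitPrefix; rewrite prefix_cons eqxx.
- exact: (@SplitExt _ _ u v').
- exact: (@SplitDiv _ _ (s :: p) a b v' w').
Qed.

Lemma plex_cat p v w : plex (p ++ v) (p ++ w) = plex v w.
Proof. by elim: p => //= s p ->; rewrite ltnn eqxx. Qed.

Lemma plex_prefix v w : prefix v w -> plex v w.
Proof. by case/prefixP => u ->; rewrite -{1}[v]cats0 plex_cat. Qed.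

Lemma prec_rcons v s : prec v (rcons v s).
Proof.
rewrite precE vdrift_rcons; apply/andP; split.
  by apply/eqP => /(congr1 size); rewrite size_rcons => /eqP; rewrite ltn_eqF.
case: (posnP s) => [->|h]; last by rewrite -{1}[vdrift v]addn0 ltn_add2l h.
by rewrite addn0 eqxx plex_prefix ?orbT // -cats1 prefix_prefix.
Qed.

(** Nothing lies strictly between a vertex and its 0-child: the two have equal drift, and a
    branching against [w] is also a branching against its 0-child. *)
Lemma prec_rcons0 v w : prec v (rcons w ord0) -> preceq v w.
Proof.
rewrite precE preceqE vdrift_rcons addn0 => /andP[neq] /orP[->//|/andP[/eqP e h]].
rewrite e eqxx /=; apply/orP; right.
case: (vertex_splitP v w) => [|u v' ev|p s t v' w' ev ew st].
- exact: plex_prefix.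
- subst v; move: h neq e; rewrite -cats1 plex_cat vdrift_cat vdrift_cons /=.
  case/orP => [u0 _ /eqP|/andP[/eqP->]].
    by rewrite -[X in _ == X]addn0 eqn_add2l addn_eq0 -leqn0 leqNgt u0.
  by case: v' => //; rewrite eqxx.
- by subst; move: h; rewrite rcons_cat !plex_cat /= (negPf st) !andFb.
Qed.

End VertexOrder.

Lemma uniq_map_inj (T U : eqType) (f : T -> U) (s : seq T) :
  uniq (map f s) -> {in s &, injective f}.
Proof.
elim: s => // x s IH /= /andP[xs us] a b.
rewrite !inE => /orP[/eqP->|ha] /orP[/eqP->|hb] e //.
- by move: xs; rewrite e map_f.
- by move: xs; rewrite -e map_f.
- exact: IH.
Qed.

(** * Trees as partial labellings of vertices *)

Section TreePaths.
Variables m n : nat.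
Implicit Types (t : tree m n) (v w : vertex m) (i j : 'I_n) (s u : 'I_m.+1).

(** The children sit inside a finite function, so the inductive type is nested; this principle
    supplies the hypothesis for each of them. *)
Lemma tree_nested_ind (Q : tree m n -> Prop) :
  Q (Leaf m n) ->
  (forall i (c : {ffun 'I_m.+1 -> tree m n}), (forall s, Q (c s)) -> Q (Node i c)) ->
  forall t, Q t.
Proof.
move=> Q0 Q1; fix IH 1; case=> [|i c]; [exact: Q0|].
by apply: Q1 => s; apply: IH.
Qed.

(** Trees are compared and constructed through this partial labelling: it determines the tree
    ([lab_ext]), and every prefix-closed labelling of bounded depth is realized ([lab_build]). *)
Fixpoint lab t v : option 'I_n :=
  match v, t with
  | _, Leaf => None
  | [::], Node i _ => Some i
  | s :: v', Node _ c => lab (c s) v'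
  end.

Lemma mem_nodes t v i : ((v, i) \in nodes t) = (lab t v == Some i).
Proof.
elim/tree_nested_ind: t v i => [|j c IH] v i /=; first by case: v.
rewrite inE; case: v => [|s v] /=.
  rewrite xpair_eqE eqxx /=; case: eqP => [->|neq] /=; first by rewrite eqxx.
  have -> : (Some j == Some i) = false by apply/eqP => -[e]; case: neq.
  by apply/flattenP => -[l /mapP[s _ ->] /mapP[q _]].
rewrite -IH; apply/flattenP/idP => [[l /mapP[s' _ ->] /mapP[[w k] h [-> -> ->]]]|h] //.
exists [seq (s :: q.1, q.2) | q <- nodes (c s)]; first by apply: map_f; rewrite mem_enum.
by apply/mapP; exists (v, i).
Qed.

Lemma uniq_nodes t : uniq (nodes t).
Proof.
elim/tree_nested_ind: t => [|j c IH] //=; apply/andP; split.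
  by apply/flattenP => -[l /mapP[s _ ->] /mapP[q _]].
have: uniq (enum 'I_m.+1) by exact: enum_uniq.
elim: (enum 'I_m.+1) => //= s l IHl /andP[sl ul].
rewrite cat_uniq IHl // andbT map_inj_uniq ?IH /=; last by move=> [? ?] [? ?] [-> ->].
apply/hasPn => q /flattenP[l' /mapP[s' s'l ->] /mapP[r _ ->]] /=.
by apply/mapP => -[r' _ [e]]; rewrite -e s'l in sl.
Qed.

Lemma lab_child_leaf t v u j : lab t v = Some j ->
  subtree t (rcons v u) = Some (Leaf m n) <-> lab t (rcons v u) = None.
Proof.
elim: v t => [|s v IH] [|i c] //=; last exact: IH.
by case: (c u) => //=.
Qed.

Lemma lab_rcons t v u i : lab t (rcons v u) = Some i -> exists j, lab t v = Some j.
Proof.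
elim: v t => [|s v IH] [|j c] //=; last exact: IH.
by exists j.
Qed.

Lemma lab_ext t t' : (forall v, lab t v = lab t' v) -> t = t'.
Proof.
elim/tree_nested_ind: t t' => [|i c IH] [|i' c'] h //; try by have := h [::].
have [<-] : Some i = Some i' by have := h [::].
congr Node; apply/ffunP => s; apply: IH => v; exact: (h (s :: v)).
Qed.

Section Labelled.
Variables (t : tree m n) (ht : is_mn_tree t).

Lemma labels_uniq : uniq (labels t).
Proof. by rewrite (perm_uniq ht) enum_uniq. Qed.

Lemma lab_node_path i : lab t (node_path t i) = Some i.
Proof.
have il : i \in labels t by rewrite (perm_mem ht) mem_enum.
apply/eqP; rewrite -mem_nodes /node_path.
have hs : (index i (labels t) < size (nodes t))%N by rewrite -(size_map snd) index_mem.
rewrite (nth_map ([::], i)) //.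
rewrite [X in (_, X)](_ : i = (nth ([::], i) (nodes t) (index i (labels t))).2).
  by rewrite -surjective_pairing mem_nth.
by rewrite -[RHS](nth_map _ i) // nth_index.
Qed.

Lemma lab_some v i : lab t v = Some i <-> node_path t i = v.
Proof.
split=> [h|<-]; last exact: lab_node_path.
have /eqP h1 := h; rewrite -mem_nodes in h1.
have /eqP h2 := lab_node_path i; rewrite -mem_nodes in h2.
have inj : {in nodes t &, injective snd}.
  exact/uniq_map_inj/labels_uniq.
by have := inj _ _ h2 h1 erefl => -[].
Qed.

Lemma node_path_inj : injective (node_path t).
Proof.
by move=> i j e; have := lab_node_path i; rewrite e lab_node_path => -[].
Qed.

Lemma node_path_parent i v s : node_path t i = rcons v s -> exists j, node_path t j = v.
Proof.
by move=> /lab_some /lab_rcons[j /lab_some h]; exists j.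
Qed.

Lemma node_path_prefix i v : prefix v (node_path t i) -> exists j, node_path t j = v.
Proof.
case/prefixP => w; elim/last_ind: w i => [|w s IH] i; first by rewrite cats0; exists i.
by rewrite -rcons_cat => /node_path_parent[j]; apply: IH.
Qed.

Lemma child_leafP j u :
  subtree t (child_vertex t j u) = Some (Leaf m n) <->
  forall k, node_path t k <> child_vertex t j u.
Proof.
rewrite /child_vertex (lab_child_leaf u (lab_node_path j)); split=> [h k e|h].
  by rewrite -e lab_node_path in h.
by case E: lab => [k|] //; have := h k; case; apply/lab_some.
Qed.

End Labelled.

Lemma node_path_ext t t' : is_mn_tree t -> is_mn_tree t' ->
  node_path t =1 node_path t' -> t = t'.
Proof.
move=> ht ht' h; apply: lab_ext => v.
case E: (lab t v) => [i|].
  by have /(lab_some ht) := E; rewrite h => /(lab_some ht').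
case E': (lab t' v) => [i|] //.
by have /(lab_some ht') := E'; rewrite -h => /(lab_some ht); rewrite E.
Qed.

(** The fuel [k] bounds the depth; it has to exceed the length of every labelled vertex. *)
Fixpoint build_tree k (f : vertex m -> option 'I_n) : tree m n :=
  match k, f [::] with
  | k'.+1, Some i => Node i [ffun s => build_tree k' (fun v => f (s :: v))]
  | _, _ => Leaf m n
  end.

Lemma lab_build k (f : vertex m -> option 'I_n) :
  (forall v s, f (rcons v s) -> f v) ->
  (forall v, f v -> (size v < k)%N) ->
  lab (build_tree k f) =1 f.
Proof.
elim: k f => [|k IH] f clo bd v /=.
  have -> : f v = None by case E: (f v) => //; have := bd v; rewrite E => /(_ isT).
  by case: v.
case E: (f [::]) => [i|].
  case: v => [|s v] /=; first by rewrite E.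
  rewrite ffunE IH // => [w u|w]; first by rewrite -rcons_cons; apply: clo.
  by move/bd.
have fN : forall w, f w = None.
  elim/last_ind => // w s h; case F: (f (rcons w s)) => [j|] //.
  by have := clo w s; rewrite F h => /(_ isT).
by case: v => [|s v]; rewrite fN.
Qed.

Lemma exists_tree (P : 'I_n -> vertex m) : injective P ->
  (forall i v s, P i = rcons v s -> exists j, P j = v) ->
  exists2 t, is_mn_tree t & node_path t =1 P.
Proof.
move=> injP cloP; pose f v := [pick i | P i == v].
have fE v i : f v = Some i <-> P i = v.
  rewrite /f; case: pickP => [j /eqP e|h]; split=> //.
  - by case=> <-.
  - by rewrite -e => /injP ->.
  - by move=> e; have := h i; rewrite e eqxx.
have labE : lab (build_tree (\max_i (size (P i)).+1) f) =1 f.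
  apply: lab_build => [v s|v].
    by case E: f => [i|] // _; have /fE/cloP[j /fE ->] := E.
  by case E: f => [i|] // _; have /fE <- := E; apply: (leq_bigmax i).
have mn : is_mn_tree (build_tree (\max_i (size (P i)).+1) f).
  apply: uniq_perm; rewrite ?enum_uniq //.
    rewrite /labels map_inj_in_uniq ?uniq_nodes // => -[v i] [w j].
    rewrite !mem_nodes !labE /= => /eqP/fE <- /eqP/fE <- -> //.
  move=> i; rewrite mem_enum inE; apply/mapP; exists (P i, i) => //.
  by rewrite mem_nodes labE; apply/eqP/fE.
by exists (build_tree (\max_i (size (P i)).+1) f) => // i; apply/(lab_some mn); rewrite labE; apply/fE.
Qed.

End TreePaths.

(** * Blocks of a marked tree *)

Lemma set2_eq (T : finType) (a b i j : T) : a != b ->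
  [set a; b]%SET = [set i; j]%SET -> a = i /\ b = j \/ a = j /\ b = i.
Proof.
move=> ab e.
have /orP[/eqP ai|/eqP aj] : (a == i) || (a == j) by rewrite -in_set2 -e set21.
- have : b \in [set i; j]%SET by rewrite -e set22.
  by rewrite in_set2 => /orP[/eqP bi|/eqP ->]; [move: ab; rewrite ai bi eqxx|left].
- have : b \in [set i; j]%SET by rewrite -e set22.
  by rewrite in_set2 => /orP[/eqP ->|/eqP bj]; [right|move: ab; rewrite aj bj eqxx].
Qed.

(** The crossing edge is kept in the component of [a], so that both its ends stay in the block when
    this is applied to a block. *)
Lemma connect_cut (T : finType) (e : rel T) (S : pred T) a b :
  connect e a b -> S a -> ~~ S b -> exists c d, [/\ e c d, S c, ~~ S d & connect e a c /\ connect e a d].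
Proof.
case/connectP => p; elim: p a => [|c p IH] a /=; first by move=> _ -> ->.
case/andP => eac pth lst Sa Sb; case Sc: (S c); last first.
  by exists a, c; rewrite Sa Sc; split=> //; split; [exact: connect0|exact: connect1].
have [d [d' [h1 h2 h3 [h4 h5]]]] := IH _ pth lst Sc Sb.
by exists d, d'; split=> //; split; apply: connect_trans (connect1 eac) _.
Qed.

Section MarkedTree.
Variables (m n : nat) (t : tree m n) (mu : edges n).
Hypothesis mt : is_marked_tree t mu.
Implicit Types (a b c d i j k : 'I_n) (s u : 'I_m.+1) (v w p : vertex m).

Local Notation P := (node_path t).

Let tT : is_mn_tree t. Proof. by case: mt. Qed.

Let P_inj : injective P := node_path_inj tT.

(** A marked edge is recorded at its child endpoint, which makes marked edges and marked nodes
    equinumerous. *)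
Definition marked i := [exists j, exists s, is_child t i j s && ([set i; j]%SET \in mu)].

(** Boolean form of [equiv]: a walk through marked edges shortens to a simple path of the tree. *)
Definition same_block a b := connect (fun c d => [set c; d]%SET \in mu) a b.

Lemma child_neq i j s : is_child t i j s -> i != j.
Proof.
rewrite /is_child => /eqP e; apply/eqP => ij; subst; move/(congr1 size): e.
by rewrite size_rcons => /eqP; rewrite ltn_eqF.
Qed.

Lemma child_parent_inj i j j' s s' : is_child t i j s -> is_child t i j' s' -> j = j' /\ s = s'.
Proof. by rewrite /is_child => /eqP -> /eqP /rcons_inj[/P_inj -> ->]. Qed.

Lemma marked_edge_cadet a b : [set a; b]%SET \in mu ->
  a != b /\ exists s, is_cadet t a b s \/ is_cadet t b a s.
Proof.
case: mt => _ h _ /h[i [j [s [cij e]]]].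
have ij : i != j by case: cij => /child_neq.
have [[<- <-]|[<- <-]] := set2_eq ij (esym e); first by split=> //; exists s; left.
by rewrite eq_sym; split=> //; exists s; right.
Qed.

Lemma marked_child_cadet i j s : is_child t i j s -> [set i; j]%SET \in mu -> is_cadet t i j s.
Proof.
move=> cij /marked_edge_cadet[_ [u [[]|[]]]] cu h.
  by have [_ ->] := child_parent_inj cij cu.
move: cij cu => /eqP e1 /eqP; rewrite /child_vertex e1 => /(congr1 size); rewrite !size_rcons; lia.
Qed.

Lemma cadet_max i j s k u : is_cadet t i j s -> is_child t k j u -> (u <= s)%N.
Proof.
move=> [_ h] /eqP ck; rewrite leqNgt; apply/negP => su.
by have /(child_leafP tT)/(_ k) := h u su.
Qed.

Lemma same_blockP a b : equiv t mu a b <-> same_block a b.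
Proof.
split=> [[->|[p [_ _ <- pth]]]|]; first exact: connect0.
  by apply/connectP; exists p.
case/connectP => p pth ->; case: (shortenP pth) => q qpth uq _.
right; exists q; split=> //; apply: sub_path qpth => e f /marked_edge_cadet[_ [s h]].
by apply/fintype.existsP; exists s; case: h => -[->] _; rewrite ?orbT.
Qed.

Lemma same_block_sym : symmetric same_block.
Proof. by apply: sym_connect_sym => a b; rewrite finset.setUC. Qed.

Lemma same_block_trans : transitive same_block.
Proof. exact: connect_trans. Qed.

(* An unmarked node is the top of its block, and [tops i] determines the block
   of [i]. *)
Definition tops i := [set k | ~~ marked k & prefix (P k) (P i)]%SET.

Lemma prefix_rconsE v w s : prefix v (rcons w s) = (v == rcons w s) || prefix v w.
Proof.
apply/idP/orP => [/prefixP[u]|[/eqP->|h]]; last 2 first.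
- exact: prefix_refl.
- by apply: prefix_trans h _; rewrite -cats1 prefix_prefix.
case/lastP: u => [|u x]; first by rewrite cats0 => ->; left; rewrite eqxx.
by rewrite -rcons_cat => /rcons_inj[-> _]; right; rewrite prefix_prefix.
Qed.

Lemma tops_prefix a b : prefix (P a) (P b) -> tops a \subset tops b.
Proof.
by move=> h; apply/fintype.subsetP => k; rewrite !inE => /andP[-> /prefix_trans]; apply.
Qed.

Lemma tops_child i j s : is_child t i j s -> marked i -> tops i = tops j.
Proof.
move=> /eqP cij mi; apply/finset.setP => k; rewrite !inE cij prefix_rconsE -/(child_vertex t j s) -cij.
by case: eqP => // /P_inj ->; rewrite mi.
Qed.

Lemma marked_edge_tops a b : [set a; b]%SET \in mu -> tops a = tops b.
Proof.
move=> h; have [_ [s [[ca _]|[cb _]]]] := marked_edge_cadet h.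
  by apply: tops_child (ca) _; apply/fintype.existsP; exists b; apply/fintype.existsP; exists s; rewrite ca.
by apply/esym/(tops_child cb); apply/fintype.existsP; exists a; apply/fintype.existsP; exists s; rewrite cb finset.setUC.
Qed.

Lemma same_block_tops a b : same_block a b -> tops a = tops b.
Proof.
case/connectP => p; elim: p a => [|c p IH] a /= => [_ -> //|/andP[/marked_edge_tops -> h1 h2]].
exact: IH.
Qed.

Lemma prefix_inj a b : prefix (P a) (P b) -> prefix (P b) (P a) -> a = b.
Proof.
case/prefixP => v e1 /prefixP[w e2]; apply: P_inj; rewrite e1; move: e1; rewrite e2 -catA.
move/(congr1 size); rewrite !size_cat; case: v => [|x v]; first by rewrite cats0.
by rewrite /=; lia.
Qed.

Lemma unmarked_tops i : ~~ marked i -> i \in tops i.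
Proof. by move=> h; rewrite inE h prefix_refl. Qed.


Lemma prefix_strict a b : prefix (P a) (P b) -> a != b ->
  exists b' s, is_child t b b' s /\ prefix (P a) (P b').
Proof.
move=> ab neq.
have [e|[v [s e]]] : P b = [::] \/ exists v s, P b = rcons v s.
- by case: (lastP (P b)) => [|v s]; [left|right; exists v, s].
  move: ab neq; rewrite e; case E: (P a) => // _ /eqP[]; apply: P_inj.
  by rewrite E e.
have [b' e'] := node_path_parent tT e; exists b', s; split; first by rewrite /is_child e -e'.
move: ab; rewrite e prefix_rconsE -e => /orP[/eqP/P_inj eab|]; last by rewrite e'.
by rewrite eab eqxx in neq.
Qed.

(** Climbing from [b]: an unmarked [b] would belong to [tops b], hence to [tops a], and would be an
    ancestor of [a]. So the edge above [b] is marked, and its parent still has the same [tops]. *)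
Lemma tops_same_prefix a b : prefix (P a) (P b) -> tops a = tops b -> same_block a b.
Proof.
have [N] := ubnP (size (P b)); elim: N b => // N IH b sb ab tab.
have [->|neq] := eqVneq a b; first exact: connect0.
have [b' [s [cb ab']]] := prefix_strict ab neq.
have /eqP eb := cb; have bb' : prefix (P b') (P b) by rewrite eb prefix_rcons.
have tb' : tops a = tops b'.
  by apply/eqP; rewrite finset.eqEsubset tops_prefix //= tab tops_prefix.
have mb : marked b.
  apply: contraT => /unmarked_tops; rewrite -tab inE => /andP[_ ba].
  by rewrite (prefix_inj ab ba) eqxx in neq.
case/fintype.existsP: mb => b1 /fintype.existsP[s1 /andP[cb1 mb]].
have [e1 _] := child_parent_inj cb cb1; subst b1.
apply: (@same_block_trans b').
  by apply: IH => //; move: sb; rewrite eb size_rcons.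
by apply: connect1; rewrite /= finset.setUC.
Qed.

Lemma marked_child a b s : is_child t b a s -> same_block a b -> [set b; a]%SET \in mu.
Proof.
move=> cb /same_block_tops tab.
have mb : marked b.
  apply: contraT => /unmarked_tops; rewrite -tab inE => /andP[_ /size_prefix].
  by move/eqP: cb => ->; rewrite size_rcons ltnn.
case/fintype.existsP: mb => b1 /fintype.existsP[s1 /andP[cb1 mb]].
by have [-> _] := child_parent_inj cb cb1.
Qed.

(** Only cadet edges are marked, and the [u]-child is no cadet, since its larger sibling on the way
    to [a] is a node. *)
Lemma div_unmarked p s u a b v w : P a = p ++ s :: v -> P b = p ++ u :: w -> (u < s)%N ->
  exists b1, [/\ ~~ marked b1, P b1 = rcons p u & prefix (P b1) (P b)].
Proof.
move=> ea eb us.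
have [b1 e1] : exists b1, P b1 = rcons p u.
  by apply: (node_path_prefix tT (i := b)); rewrite eb -cat_rcons prefix_prefix.
have [a1 f1] : exists a1, P a1 = rcons p s.
  by apply: (node_path_prefix tT (i := a)); rewrite ea -cat_rcons prefix_prefix.
have [c ec] := node_path_parent tT e1.
exists b1; split=> //; last by rewrite e1 eb -cat_rcons prefix_prefix.
apply/negP => /fintype.existsP[c' /fintype.existsP[u' /andP[cb mb]]].
have cb1 : is_child t b1 c u by rewrite /is_child e1 /child_vertex ec.
have [ecc euu] := child_parent_inj cb cb1; subst c' u'.
have ca1 : is_child t a1 c s by rewrite /is_child f1 /child_vertex ec.
by have := cadet_max (marked_child_cadet cb1 mb) ca1; rewrite leqNgt us.
Qed.

Lemma prefix_rcons_div p (s u : 'I_m.+1) v : prefix (rcons p u) (p ++ s :: v) -> u = s.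
Proof.
case/prefixP => w; rewrite cat_rcons => /eqP.
by rewrite eqseq_cat // eqseq_cons eqxx /= => /andP[/eqP -> _].
Qed.

(** Blocks never branch: the unmarked child on the smaller side lies above only one of the two
    nodes. *)
Lemma div_tops p s u a b v w : P a = p ++ s :: v -> P b = p ++ u :: w -> s != u ->
  tops a != tops b.
Proof.
wlog us : s u a b v w / (u < s)%N => [wl ea eb su|ea eb _].
  case: (ltngtP s u) => [h|h|/val_inj h]; last by rewrite h eqxx in su.
    by rewrite eq_sym; apply: (wl _ _ _ _ _ _ h eb ea); rewrite eq_sym.
  exact: (wl _ _ _ _ _ _ h ea eb).
have [b1 [nb1 e1 pb1]] := div_unmarked ea eb us.
apply/eqP => tab; have : b1 \in tops b by rewrite inE nb1.
rewrite -tab inE nb1 /= e1 ea => /prefix_rcons_div eus.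
by rewrite eus ltnn in us.
Qed.

Lemma tops_same a b : tops a = tops b -> same_block a b.
Proof.
move=> tab; case: (vertex_splitP (P a) (P b)) => [h|u v e|p s u v w ea eb su].
- exact: tops_same_prefix.
- by rewrite same_block_sym; apply: tops_same_prefix => //; rewrite e prefix_prefix.
- by have := div_tops ea eb su; rewrite tab eqxx.
Qed.

Lemma block_chain a b : same_block a b -> prefix (P a) (P b) || prefix (P b) (P a).
Proof.
move=> /same_block_tops tab; case: (vertex_splitP (P a) (P b)) => [-> //|u v ->|p s u v w ea eb su].
  by rewrite prefix_prefix orbT.
by have := div_tops ea eb su; rewrite tab eqxx.
Qed.

Lemma block_between a b c : same_block a b -> prefix (P a) (P c) -> prefix (P c) (P b) ->
  same_block a c.
Proof.
move=> /same_block_tops tab ac cb; apply: tops_same; apply/eqP.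
by rewrite finset.eqEsubset (tops_prefix ac) tab (tops_prefix cb).
Qed.

(** Each marked edge on the way down either raises the drift or is a marked 0-cadet edge, whose
    child has the larger label. *)
Lemma block_prefix_lt a b : same_block a b -> prefix (P a) (P b) -> a != b ->
  (drift t a < drift t b)%N || (drift t a == drift t b) && (a < b)%N.
Proof.
have [N] := ubnP (size (P b)); elim: N b => // N IH b sb ab pab neq.
have [b' [s [cb pab']]] := prefix_strict pab neq.
have /eqP eb := cb; have pb'b : prefix (P b') (P b) by rewrite eb prefix_rcons.
have ab' := block_between ab pab' pb'b.
have b'b : same_block b' b by apply: same_block_trans ab; rewrite same_block_sym.
have mb := marked_child cb b'b.
have db : drift t b = (drift t b' + s)%N by rewrite /drift eb vdrift_rcons.
have IHb : a != b' -> (drift t a < drift t b')%N || (drift t a == drift t b') && (a < b')%N.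
  by apply: IH => //; move: sb; rewrite eb size_rcons.
case: (posnP s) => [s0|s0].
  have {}s0 : s = ord0 by apply: val_inj.
  have lt : (b' < b)%N.
    case: mt => _ _; apply; last by rewrite finset.setUC; exact: mb.
    by rewrite -s0; exact: marked_child_cadet.
  rewrite db s0 addn0; case: (eqVneq a b') IHb => [-> _|_ /(_ isT) /orP[->//|/andP[-> h]]].
    by rewrite eqxx lt orbT.
  by rewrite (ltn_trans h lt) orbT.
case: (eqVneq a b') IHb => [-> _|_ /(_ isT)]; first by rewrite db -{1}[drift t b']addn0 ltn_add2l s0.
by rewrite db; lia.
Qed.

(** The ancestor order of a block thus depends only on drift differences and labels, so it can be
    carried over to another tree with the same face. *)
Lemma block_prefixE a b : same_block a b ->
  prefix (P a) (P b) = (drift t a < drift t b)%N || (drift t a == drift t b) && (a <= b)%N.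
Proof.
move=> ab; have [->|neq] := eqVneq a b; first by rewrite prefix_refl eqxx leqnn orbT.
have := block_chain ab; case E: (prefix (P a) (P b)) => /= h.
  by have := block_prefix_lt ab E neq; lia.
have ba : same_block b a by rewrite same_block_sym.
have := block_prefix_lt ba h; rewrite eq_sym neq => /(_ isT); lia.
Qed.

Lemma block_last c c' : (forall k s, is_child t k c s -> [set k; c]%SET \notin mu) ->
  same_block c' c -> prefix (P c') (P c).
Proof.
move=> hc cc'; case/orP: (block_chain cc') => // pcc'.
case: (eqVneq c c') => [->|neq]; first exact: prefix_refl.
case/prefixP: pcc' (pcc') => -[|u w] e pcc'.
  by case/eqP: neq; apply: P_inj; rewrite e cats0.
have [k ek] : exists k, P k = rcons (P c) u.
  by apply: (node_path_prefix tT (i := c')); rewrite e -cat_rcons prefix_prefix.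
have ck : is_child t k c u by rewrite /is_child ek.
have := hc k u ck; rewrite (marked_child ck) //.
apply: (@block_between _ c'); first by rewrite same_block_sym.
  by rewrite ek prefix_rcons.
by rewrite ek e -cat_rcons prefix_prefix.
Qed.

Lemma unmarked_top a b : ~~ marked a -> same_block a b -> prefix (P a) (P b).
Proof.
by move=> /unmarked_tops h /same_block_tops e; move: h; rewrite e inE => /andP[].
Qed.

End MarkedTree.

(** * Faces as sign cells *)

(** Applied with [z] a difference of drifts minus [s] and [f] a difference of offsets. *)
Lemma sg_int_frac (R : realType) (z : int) (f : R) : -1 < f < 1 ->
  Num.sg (z%:~R + f) = if z == 0 then Num.sg f else Num.sg z%:~R.
Proof.
case/andP => f1 f2; case: (ltrgtP z 0) => [z0|z0|->]; last by rewrite add0r.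
- have hz : (z%:~R : R) <= -1 by rewrite -[-1]/((-1)%:~R) ler_int; lia.
  by rewrite !ltr0_sg //; lra.
- have hz : 1 <= (z%:~R : R) by rewrite -[1]/(1%:~R) ler_int; lia.
  by rewrite !gtr0_sg //; lra.
Qed.

Lemma sg_eq_lt0 (R : realType) (x y : R) : Num.sg x = Num.sg y -> (x < 0) = (y < 0).
Proof. by move=> e; rewrite -sgr_lt0 e sgr_lt0. Qed.

Lemma sg_eq_gt0 (R : realType) (x y : R) : Num.sg x = Num.sg y -> (0 < x) = (0 < y).
Proof. by move=> e; rewrite -sgr_gt0 e sgr_gt0. Qed.

Lemma sg_eq_eq0 (R : realType) (x y : R) : Num.sg x = Num.sg y -> (x == 0) = (y == 0).
Proof. by move=> e; rewrite -sgr_eq0 e sgr_eq0. Qed.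

Lemma sg_swap (R : realType) (a b : R) (s : int) :
  Num.sg (a - b - (- s)%:~R) = - Num.sg (b - a - s%:~R).
Proof. by rewrite -sgrN rmorphN /=; congr Num.sg; ring. Qed.

Section Cells.
Variables (R : realType) (n : nat).
Implicit Types (A : set (set 'rV[R]_n)) (x y : 'rV[R]_n) (i j : 'I_n) (s : int).

Lemma hyperplane_sym i j s : @hyperplane R n i j s = hyperplane j i (- s).
Proof.
by apply/seteqP; split => x; rewrite /hyperplane /= rmorphN /=; lra.
Qed.

(** Unlike in [is_face], all ordered pairs are allowed, so either equation of a hyperplane can be
    used; [sg_swap] reconciles the two forms. *)
Definition cell A x : set 'rV[R]_n :=
  [set y | forall i j s, A (hyperplane i j s) ->
     Num.sg (y ord0 i - y ord0 j - s%:~R) = Num.sg (x ord0 i - x ord0 j - s%:~R)].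

Lemma cell_refl A x : cell A x x.
Proof. by []. Qed.

Lemma cell_eq A x y : cell A x y -> cell A y = cell A x.
Proof.
by move=> h; apply/seteqP; split => z hz i j s As; rewrite (hz _ _ _ As) (h _ _ _ As).
Qed.

(** Membership in the Catalan arrangement is an equality of sets and gives some other equation of
    the same hyperplane; evaluating both equations at test points identifies them up to swapping. *)
Lemma hyperplane_catalan m i j s : @catalan R n m (hyperplane i j s) ->
  i != j /\ - m%:Z <= s <= m%:Z.
Proof.
case=> k [l [r [kl rm e]]].
pose pt (a : 'I_n) (z : R) : 'rV[R]_n := \row_b (if b == a then z else 0).
have ptE a z b : pt a z ord0 b = if b == a then z else 0 by rewrite mxE.
have klN : k != l by apply/eqP => h; rewrite h ltnn in kl.
have inE x : x ord0 i - x ord0 j = s%:~R <-> x ord0 k - x ord0 l = r%:~R.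
  by have := congr1 (fun S => S x) e; rewrite /hyperplane /= => ->.
have lk : (l == k) = false by rewrite eq_sym; exact: negbTE.
have ij : i != j.
  (* For [i = j] the equation holds everywhere or nowhere, while the one in [k] and [l] does
     neither. *)
  apply/eqP => ij; subst j.
  have h1 : pt k (r%:~R) ord0 i - pt k (r%:~R) ord0 i = s%:~R.
    by apply/inE; rewrite !ptE eqxx lk subr0.
  have : pt k (r%:~R + 1) ord0 k - pt k (r%:~R + 1) ord0 l = r%:~R.
    by apply/inE; rewrite -h1 !subrr.
  by rewrite !ptE eqxx lk; lra.
have ji : (j == i) = false by rewrite eq_sym; exact: negbTE.
split=> //.
pose y := pt i (s%:~R).
have hy : y ord0 k - y ord0 l = r%:~R by apply/inE; rewrite !ptE eqxx ji subr0.
have kij : (k == i) || (k == j).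
  (* If [k] were neither [i] nor [j], moving coordinate [k] would preserve one equation and break
     the other. *)
  apply: contraT; rewrite negb_or => /andP[/negbTE ki /negbTE kj].
  have : (y + pt k 1) ord0 k - (y + pt k 1) ord0 l = r%:~R.
    by apply/inE; rewrite !mxE eqxx ji !(eq_sym _ k) ki kj !addr0 subr0.
  by rewrite !mxE eqxx lk -hy !mxE; lra.
have lij : (l == i) || (l == j).
  apply: contraT; rewrite negb_or => /andP[/negbTE ki /negbTE kj].
  have : (y + pt l 1) ord0 k - (y + pt l 1) ord0 l = r%:~R.
    by apply/inE; rewrite !mxE eqxx ji !(eq_sym _ l) ki kj !addr0 subr0.
  by rewrite !mxE eqxx (negbTE klN) -hy !mxE; lra.
move: hy; rewrite !ptE; case/orP: kij => /eqP kk; subst k.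
  rewrite eqxx lk subr0 => /eqP; rewrite eqr_int => /eqP ->; exact: rm.
case/orP: lij => /eqP ll; subst l; last by rewrite eqxx in klN.
by rewrite eqxx ji sub0r -rmorphN => /eqP; rewrite eqr_int => /eqP h; move: rm; rewrite -h; lia.
Qed.

Lemma face_cellP m A F : A `<=` @catalan R n m ->
  is_face A F <-> exists2 x, F x & F = cell A x.
Proof.
move=> hA; split=> [[[x Fx] [e eF]]|[x Fx eF]].
  exists x => //; apply/seteqP; split => y.
    move=> Fy i j s As; have [ij _] := hyperplane_catalan (hA _ As).
    wlog lt : i j s As ij / (i < j)%N => [wl|].
      case: (ltngtP i j) => h; first exact: wl.
        have As' := As; rewrite hyperplane_sym in As'.
        have := wl j i (- s) As'; rewrite eq_sym ij => /(_ isT h).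
        by rewrite !sg_swap => /oppr_inj.
      by rewrite (val_inj h) eqxx in ij.
    move: Fx Fy; rewrite eF => /(_ i j s lt As) h1 /(_ i j s lt As).
    case: (e i j s) h1 => /= h1 h2.
    - by rewrite h1 h2 !subrr.
    - by rewrite !ltr0_sg //; lra.
    - by rewrite !gtr0_sg //; lra.
  move=> cy; rewrite eF => i j s lt As; have := cy i j s As.
  move: Fx; rewrite eF => /(_ i j s lt As).
  case: (e i j s) => /= h1 h.
  - by have := sg_eq_eq0 h; rewrite h1 subrr eqxx; lra.
  - by have := sg_eq_lt0 h; lra.
  - by have := sg_eq_gt0 h; lra.
split; first by exists x.
exists (fun i j s => if x ord0 i - x ord0 j < s%:~R then Lt
   else if x ord0 i - x ord0 j == s%:~R then Eq else Gt).
rewrite eF; apply/seteqP; split => y.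
  move=> cy i j s lt As; have h := cy i j s As.
  have := sg_eq_eq0 h; have := sg_eq_lt0 h; have := sg_eq_gt0 h.
  by case: (ltrgtP (x ord0 i - x ord0 j) s%:~R) => /=; lra.
move=> cy i j s As; have [ij _] := hyperplane_catalan (hA _ As).
wlog lt : i j s As ij / (i < j)%N => [wl|].
  case: (ltngtP i j) => h; first exact: wl.
    have As' := As; rewrite hyperplane_sym in As'.
    have := wl j i (- s) As'; rewrite eq_sym ij => /(_ isT h).
    by rewrite !sg_swap => /oppr_inj.
  by rewrite (val_inj h) eqxx in ij.
have := cy i j s lt As.
case: (ltrgtP (x ord0 i - x ord0 j) s%:~R) => /= h1 h2.
- by rewrite !ltr0_sg //; lra.
- by rewrite !gtr0_sg //; lra.
- by rewrite h1 h2 !subrr.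
Qed.

End Cells.

(** * The point attached to a marked tree *)

Section Offsets.
Variables (R : realType) (m n : nat) (t : tree m n) (mu : edges n).
Hypothesis mt : is_marked_tree t mu.
Implicit Types (a b c i j k : 'I_n) (s u : 'I_m.+1) (v w p : vertex m).
Local Notation P := (node_path t).
Local Notation tops := (tops t mu).
Local Notation same_block := (same_block mu).

Let delta : R := (n.+1)%:R^-1.

Definition offset i : R := \sum_(k in tops i) delta ^+ (drift t k).+1.

Let delta_gt0 : 0 < delta. Proof. by rewrite invr_gt0 ltr0n. Qed.
Let delta_le1 : delta <= 1. Proof. by rewrite invf_le1 ?ltr0n // ler1n. Qed.

(** There are at most [n] terms, each at most [delta ^+ d.+1], and [n * delta < 1]. *)
Lemma level_sum_lt (S : {set 'I_n}) (d : nat) :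
  (forall k, k \in S -> (d <= drift t k)%N) ->
  \sum_(k in S) delta ^+ (drift t k).+1 < delta ^+ d.
Proof.
move=> h; apply: (@le_lt_trans _ _ (\sum_(k in S) delta ^+ d.+1)).
  apply: ler_sum => k /h kd; apply: ler_wiXn2l => //; exact: ltW.
rewrite sumr_const exprS -mulrnAl -[ltRHS]mul1r ltr_pM2r ?exprn_gt0 //.
rewrite -(mulVf (_ : n.+1%:R != 0 :> R)) ?pnatr_eq0 // mulr_natr ltr_pMn2l //.
by rewrite ltnS; have := max_card (mem S); rewrite card_ord.
Qed.

Lemma offset_ge0 i : 0 <= offset i.
Proof. by apply: sumr_ge0 => k _; apply: exprn_ge0; exact: ltW. Qed.

Lemma offset_lt1 i : offset i < 1.
Proof. by rewrite -(expr0 delta); apply: level_sum_lt. Qed.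

Lemma offset_diff i j : -1 < offset i - offset j < 1.
Proof.
have := offset_ge0 i; have := offset_ge0 j; have := offset_lt1 i; have := offset_lt1 j.
by move=> *; apply/andP; split; lra.
Qed.

Lemma offset_same a b : same_block a b -> offset a = offset b.
Proof. by move=> /(same_block_tops mt) e; rewrite /offset e. Qed.

Lemma offset_subset (S T : {set 'I_n}) : S \subset T ->
  \sum_(k in S) delta ^+ (drift t k).+1 <= \sum_(k in T) delta ^+ (drift t k).+1.
Proof.
move=> ST; rewrite [leRHS](big_setID S) /= (finset.setIidPr ST) lerDl.
by apply: sumr_ge0 => k _; apply: exprn_ge0; exact: ltW.
Qed.

Lemma offset_prefix a b : prefix (P a) (P b) -> offset a <= offset b.
Proof. by move=> h; apply/offset_subset/tops_prefix. Qed.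

Lemma offset_prefix_lt a b : prefix (P a) (P b) -> ~~ same_block a b -> offset a < offset b.
Proof.
move=> h ns; have ST := tops_prefix mu h.
have : tops a \proper tops b.
  rewrite finset.properEneq ST andbT; apply: contra ns => /eqP; exact: tops_same.
case/properP => _ [k kb ka]; rewrite /offset [ltRHS](big_setID (tops a)) /= (finset.setIidPr ST) ltrDl.
have kD : k \in tops b :\: tops a by rewrite finset.inE ka kb.
rewrite (big_setD1 k) //=; apply: ltr_pwDl; first exact: exprn_gt0.
by apply: sumr_ge0 => l _; apply: exprn_ge0; exact: ltW.
Qed.

Lemma prefix_beyond p s v w : prefix w (p ++ s :: v) -> ~~ prefix w p ->
  prefix (rcons p s) w.
Proof.
case: (vertex_splitP w p) => [-> //|u w' -> h _|q x y w' p' -> -> xy].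
  rewrite -(@prefix_rcons_div _ p s u v); first by rewrite -cat_rcons prefix_prefix.
  by apply: prefix_trans h; rewrite -cat_rcons prefix_prefix.
rewrite -catA cat_cons => h; have h' : prefix (rcons q x) (q ++ y :: (p' ++ s :: v)).
  by apply: prefix_trans h; rewrite -cat_rcons prefix_prefix.
by rewrite (prefix_rcons_div h') eqxx in xy.
Qed.

(* All unmarked nodes below the [s]-child weigh less together than the unmarked
   [u]-child alone, whose edge is unmarked because it is not a cadet. *)
Lemma offset_div p s u a b v w : P a = p ++ s :: v -> P b = p ++ u :: w -> (u < s)%N ->
  offset a < offset b.
Proof.
move=> ea eb us; pose B := [set k | prefix (P k) p]%SET.
have pC v' w' : prefix v' p -> prefix v' (p ++ w').
  by move=> h; apply: prefix_trans h _; rewrite prefix_prefix.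
have eqB : tops a :&: B = tops b :&: B.
  apply/finset.setP => k; rewrite !inE ea eb; case h: (prefix (P k) p); rewrite ?andbF //.
  by rewrite !pC.
rewrite /offset [ltLHS](big_setID B) /= [ltRHS](big_setID B) /= eqB ltrD2l.
apply: (@lt_le_trans _ _ (delta ^+ (vdrift p + s))).
  apply: level_sum_lt => k; rewrite !inE => /andP[kp /andP[_]]; rewrite ea => /prefix_beyond/(_ kp).
  by move/vdrift_prefix; rewrite vdrift_rcons.
have [b1 [nb1 e1 pb1]] := div_unmarked mt ea eb us.
have bD : b1 \in tops b :\: B.
  rewrite !inE nb1 pb1 e1 !andbT; apply/negP => /size_prefix.
  by rewrite size_rcons ltnn.
rewrite (big_setD1 b1) //= -[leLHS]addr0; apply: lerD.
  apply: ler_wiXn2l => //; first exact: ltW.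
  by rewrite /drift e1 vdrift_rcons ltn_add2l.
by apply: sumr_ge0 => l _; apply: exprn_ge0; exact: ltW.
Qed.

Lemma offset_inj a b : offset a = offset b -> same_block a b.
Proof.
move=> e; apply: contraT => ns; have ns' : ~~ same_block b a by rewrite same_block_sym.
case: (vertex_splitP (P a) (P b)) => [h|u v h|p s u v w ea eb su].
- by have := offset_prefix_lt h ns; rewrite e ltxx.
- by have := offset_prefix_lt (_ : prefix (P b) (P a)) ns'; rewrite h prefix_prefix e ltxx => /(_ isT).
- case: (ltngtP s u) => h; last by rewrite (val_inj h) eqxx in su.
    by have := offset_div eb ea h; rewrite e ltxx.
  by have := offset_div ea eb h; rewrite e ltxx.
Qed.

Lemma offset_eq a b : (offset a == offset b) = same_block a b.
Proof. by apply/eqP/idP => [/offset_inj|/offset_same]. Qed.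

Definition tree_point : 'rV[R]_n := \row_i ((drift t i)%:R + offset i).

Lemma tree_pointE i : tree_point ord0 i = (drift t i)%:R + offset i.
Proof. by rewrite mxE. Qed.

Lemma tree_point_sg a b (s : int) :
  Num.sg (tree_point ord0 a - tree_point ord0 b - s%:~R) =
  if (drift t a)%:Z - (drift t b)%:Z - s == 0 then Num.sg (offset a - offset b)
  else Num.sg (((drift t a)%:Z - (drift t b)%:Z - s)%:~R : R).
Proof.
rewrite -sg_int_frac; last exact: offset_diff.
by rewrite !tree_pointE !rmorphB /= -!pmulrn; congr Num.sg; ring.
Qed.

Lemma tree_point_same a b : same_block a b ->
  tree_point ord0 a - tree_point ord0 b = ((drift t a)%:Z - (drift t b)%:Z)%:~R.
Proof.
by move=> /offset_same e; rewrite !tree_pointE e rmorphB /= -!pmulrn; ring.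
Qed.

(** Offsets lie in [0, 1), so an integer difference forces them to be equal, and the offset
    identifies the block. *)
Lemma tree_point_int a b (s : int) :
  tree_point ord0 a - tree_point ord0 b = s%:~R ->
  same_block a b /\ s = (drift t a)%:Z - (drift t b)%:Z.
Proof.
move/eqP; rewrite -subr_eq0 -sgr_eq0 tree_point_sg; case: ifP => [/eqP e|ne].
  by rewrite sgr_eq0 subr_eq0 offset_eq => ->; split=> //; lia.
by rewrite sgr_eq0 intr_eq0 ne.
Qed.

(** With drifts tied, the vertices are compared by [plex], which agrees with the order of offsets
    both along a branch and at a branching. *)
Lemma prec_child_offset a b s : ~~ same_block a b -> drift t a = (drift t b + s)%N ->
  prec (P a) (child_vertex t b s) = (offset a < offset b).
Proof.
move=> ns dab; rewrite precE /child_vertex vdrift_rcons -!/(drift t _) dab ltnn eqxx /=.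
have ns' : ~~ same_block b a by rewrite same_block_sym.
case: (vertex_splitP (P a) (P b)) => [h|u v e|p x y v w ea eb xy].
- rewrite (offset_prefix_lt h ns) plex_prefix ?andbT; last first.
    by apply: prefix_trans h _; exact: prefix_rcons.
  by apply/eqP => e; have := size_prefix h; rewrite e size_rcons ltnn.
- have pba : prefix (P b) (P a) by rewrite e prefix_prefix.
  have h := offset_prefix_lt pba ns'.
  (* The child indices from [b] down to [a] add up to [s], so the first one is at most [s], and [a]
     cannot strictly precede the [s]-child. *)
  rewrite [RHS]ltNge (ltW h) /= e -cats1 plex_cat /=; apply/negP => /andP[/eqP neq].
  move: dab; rewrite {1}/drift e vdrift_cat vdrift_cons => /addnI dab.
  case/orP => [su|/andP[/eqP eu]]; first by move: su; rewrite -dab; lia.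
  by case: v e neq {dab} => // e neq _; apply: neq; rewrite eu.
- rewrite ea eb rcons_cat plex_cat /= (negbTE xy) orbF.
  have -> : p ++ x :: v != p ++ y :: rcons w s.
    by apply: contra xy; rewrite eqseq_cat // eqseq_cons eqxx /= => /andP[].
  case: (ltngtP x y) => h /=; last by rewrite (val_inj h) eqxx in xy.
    by rewrite [RHS]ltNge (ltW (offset_div eb ea h)).
  by rewrite (offset_div ea eb h).
Qed.

Lemma prec_child_point a b s : ~~ same_block a b ->
  prec (P a) (child_vertex t b s) = (tree_point ord0 a - tree_point ord0 b < (s : nat)%:R).
Proof.
move=> ns; rewrite -subr_lt0 -sgr_lt0 -[(s : nat)%:R]/((s : nat)%:~R) tree_point_sg.
case: eqP => [e|ne].
  by rewrite prec_child_offset // ?sgr_lt0 ?subr_lt0 //; lia.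
rewrite sgr_lt0 ltrz0 precE vdrift_rcons -!/(drift t _).
case: (ltngtP (drift t a) (drift t b + s)) => h; rewrite ?andbF ?andbT /=; last by lia.
  rewrite (_ : (P a != child_vertex t b s) = true); first by lia.
  by apply/eqP => e; move: h; rewrite /drift e vdrift_rcons ltnn.
by lia.
Qed.

End Offsets.

Lemma connect_diff (T : finType) (V : zmodType) (e : rel T) (f g : T -> V) a b :
  (forall c d, e c d -> f c - f d = g c - g d) -> connect e a b -> f a - f b = g a - g b.
Proof.
move=> h /connectP[p pth ->]; elim: p a pth => [|c p IH] a /=; first by rewrite !subrr.
case/andP => /h e1 /IH e2; rewrite -(subrKA (f c)) -[RHS](subrKA (g c)).
by rewrite e1 e2.
Qed.

(** * [Phi] as the cell of the tree point *)

Section PhiCell.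
Variables (R : realType) (m n : nat) (A : set (set 'rV[R]_n)).
Hypothesis hA : A `<=` @catalan R n m.
Implicit Types (a b c i j k : 'I_n).

Section OneTree.
Variables (t : tree m n) (mu : edges n).
Hypothesis mt : is_marked_tree t mu.
Local Notation X := (tree_point R t mu).

Definition arr_edge (c d : 'I_n) : bool :=
  [&& `[< A (drift_hyperplane t c d) >], same_block mu c d & c != d].

Lemma arr_connectedE : arr_connected A t mu ->
  forall a b, same_block mu a b -> connect arr_edge a b.
Proof.
move=> h a b ab; have inB c : (c \in block t mu a) = same_block mu a c.
  by rewrite inE; apply/asboolP/idP => /(same_blockP mt).
have := h a a b; rewrite !inB ab /same_block connect0 => /(_ isT isT).
apply: connect_sub => c d; rewrite !inB => /and4P[ac ad cd Acd]; apply: connect1.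
rewrite /arr_edge cd Acd andbT /=; apply: same_block_trans ad.
by rewrite same_block_sym.
Qed.

Lemma marked_child_same i j (s : 'I_m.+1) : [set i; j]%SET \in mu -> is_child t i j s ->
  same_block mu i j /\ drift t i = (drift t j + s)%N.
Proof.
move=> h /eqP e; split; first exact: connect1.
by rewrite /drift e vdrift_rcons.
Qed.

Lemma marked_edges_diff (x : 'rV[R]_n) :
  (forall i j (s : 'I_m.+1), [set i; j]%SET \in mu -> is_child t i j s ->
     x ord0 i - x ord0 j = (s : nat)%:R) ->
  forall a b, same_block mu a b ->
    x ord0 a - x ord0 b = (drift t a)%:R - (drift t b)%:R.
Proof.
move=> h a b; apply: (connect_diff (f := x ord0) (g := fun i => (drift t i)%:R)) => c d cd.
have [_ [s [[cs _]|[cs _]]]] := marked_edge_cadet mt cd.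
  have [_ ->] := marked_child_same cd cs.
  by rewrite (h _ _ _ cd cs) natrD; ring.
rewrite finset.setUC in cd; have [_ ->] := marked_child_same cd cs.
by rewrite -[LHS]opprB (h _ _ _ cd cs) natrD; ring.
Qed.

(** Between blocks, the inequalities of [Phi] are the signs of the tree point by [prec_child_point].
    Inside a block, the marked edges generate all equalities of [Phi], and connectedness generates
    the same ones from hyperplanes of [A]. *)
Lemma Phi_cell : marked_trees A (t, mu) -> Phi A (t, mu) = cell A X.
Proof.
case=> /= _ conn _; apply/seteqP; split=> x.
  case=> -[/= h1 h2 h3].
  have tri i j (s : 'I_m.+1) : triple A i j s -> ~~ same_block mu i j ->
      Num.sg (x ord0 i - x ord0 j - (s : nat)%:~R) = Num.sg (X ord0 i - X ord0 j - (s : nat)%:~R).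
    move=> tr ns; have ne : ~ equiv t mu i j by move/(same_blockP mt); apply/negP.
    case E: (prec (node_path t i) (child_vertex t j s)).
      have xl := h2 _ _ _ tr ne E; rewrite (prec_child_point R mt) // in E.
      by rewrite !ltr0_sg //; lra.
    have := E; rewrite precNge => /negbFE/(h3 _ _ _ tr ne) xg.
    have Xn : X ord0 i - X ord0 j != (s : nat)%:~R.
      by apply/negP => /eqP /(tree_point_int mt) [ss]; rewrite ss in ns.
    move: E; rewrite (prec_child_point R mt) // => /negbT; rewrite -leNgt => Xg.
    rewrite !gtr0_sg //; last by lra.
    by rewrite subr_gt0 lt_neqAle eq_sym Xn.
  move=> i j s As; have [ij /andP[s1 s2]] := hyperplane_catalan (hA As).
  case ss: (same_block mu i j).
    rewrite (tree_point_same R mt ss) (marked_edges_diff h1 ss); congr Num.sg.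
    by rewrite rmorphB /= -!pmulrn.
  have key i' j' s' : i' != j' -> A (hyperplane i' j' s') -> ~~ same_block mu i' j' ->
      0 <= s' <= m%:Z -> (0 < s') || (j' < i')%N ->
      Num.sg (x ord0 i' - x ord0 j' - s'%:~R) = Num.sg (X ord0 i' - X ord0 j' - s'%:~R).
    case: s' => // s' ij' As' ns' /andP[_ s'm] pos.
    have ms : (s' < m.+1)%N by lia.
    apply: (tri i' j' (Ordinal ms)) => //; split=> //=.
  (* If [(i, j, s)] does not have the orientation required by [triple], then [(j, i, - s)] does. *)
  have [pos|neg] := boolP ((0 < s) || (s == 0) && (j < i)%N).
    by apply: key => //; rewrite ?ss //; lia.
  have jiN : nat_of_ord j <> i by move/val_inj => e; rewrite e eqxx in ij.
  have := key j i (- s); rewrite eq_sym ij same_block_sym ss -hyperplane_sym !sg_swap => h.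
  by apply: oppr_inj; apply: h => //; lia.
move=> cx; have eqx a b : same_block mu a b ->
    x ord0 a - x ord0 b = (drift t a)%:R - (drift t b)%:R.
  move/(arr_connectedE conn); apply: (connect_diff (f := x ord0) (g := fun i => (drift t i)%:R)).
  move=> c d /and3P[/asboolP Acd ss _]; have /sg_eq_eq0 := cx _ _ _ Acd.
  rewrite (tree_point_same R mt ss) subrr eqxx subr_eq0 => /eqP ->.
  by rewrite rmorphB /= -!pmulrn.
split; first split => /=.
- move=> i j s h cij; have [ss e] := marked_child_same h cij.
  by rewrite eqx // e natrD; ring.
- move=> i j s [ij pos As] ne pr.
  have ns : ~~ same_block mu i j by apply/negP => /(same_blockP mt).
  have /sg_eq_lt0 := cx _ _ _ As; move: pr; rewrite (prec_child_point R mt) //.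
  by rewrite -!pmulrn => h; lra.
- move=> i j s [ij pos As] ne pr.
  have ns : ~~ same_block mu i j by apply/negP => /(same_blockP mt).
  have /sg_eq_gt0 := cx _ _ _ As.
  have : ~~ prec (node_path t i) (child_vertex t j s) by rewrite precNge pr.
  rewrite (prec_child_point R mt) // -!pmulrn -leNgt => h.
  have Xn : X ord0 i - X ord0 j != (s : nat)%:R.
    by apply/negP => /eqP /(@tree_point_int _ _ _ _ _ mt i j s) [ss]; rewrite ss in ns.
  rewrite !subr_gt0 [in RHS]lt_neqAle h andbT eq_sym Xn; lra.
Qed.

End OneTree.
End PhiCell.

(** * Codimension *)

Section Small.
Variable R : realType.

(** Expresses that [e] tends to 0 from the right; finitely many such conditions can be met
    together. *)
Definition for_small (Q : R -> Prop) : Prop :=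
  exists2 e0, 0 < e0 & forall e, 0 < e < e0 -> Q e.

Lemma for_small_ex Q : for_small Q -> exists2 e, 0 < e & Q e.
Proof. by case=> e0 h1 h2; exists (e0 / 2); [|apply: h2; apply/andP; split]; lra. Qed.

Lemma for_small_and Q1 Q2 : for_small Q1 -> for_small Q2 -> for_small (fun e => Q1 e /\ Q2 e).
Proof.
move=> [e1 p1 h1] [e2 p2 h2]; exists (Num.min e1 e2); first by rewrite lt_min p1.
by move=> e; rewrite lt_min => /and3P[e0 l1 l2]; split; [apply: h1|apply: h2]; rewrite e0.
Qed.

Lemma for_small_sub (Q1 Q2 : R -> Prop) :
  for_small Q1 -> (forall e, 0 < e -> Q1 e -> Q2 e) -> for_small Q2.
Proof. by move=> [e0 p h] s; exists e0 => // e he; apply: s (h _ he); case/andP: he. Qed.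

Lemma for_small_fin (T : finType) (Q : T -> R -> Prop) :
  (forall x, for_small (Q x)) -> for_small (fun e => forall x, Q x e).
Proof.
move=> h; have : for_small (fun e => forall x, x \in enum T -> Q x e).
  elim: (enum T) => [|x l IH]; first by exists 1.
  apply: for_small_sub (for_small_and (h x) IH) _ => e _ [h1 h2] y.
  by rewrite inE => /orP[/eqP->|/h2].
by move/for_small_sub; apply => e _ h' x; apply: h'; rewrite mem_enum.
Qed.

Lemma for_small_lt (a b c : R) : a < b -> for_small (fun e => a + e * c < b).
Proof.
(* The added 1 keeps the divisor positive when [c] is 0. *)
move=> ab; have cp : 0 < `|c| + 1 by have := normr_ge0 c; lra.
exists ((b - a) / (`|c| + 1)); first by rewrite divr_gt0 ?subr_gt0.
move=> e /andP[e0]; rewrite ltr_pdivlMr // => h.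
have : e * c <= e * (`|c| + 1) by rewrite ler_pM2l //; have := ler_norm c; lra.
lra.
Qed.

Lemma for_small_sg (a c : R) : a != 0 -> for_small (fun e => Num.sg (a + e * c) = Num.sg a).
Proof.
rewrite neq_lt => /orP[h|h].
  by apply: for_small_sub (for_small_lt c h) _ => e _ h'; rewrite !ltr0_sg.
rewrite -oppr_lt0 in h; apply: for_small_sub (for_small_lt (- c) h) _ => e _ h'.
by rewrite !gtr0_sg //; lra.
Qed.

Lemma for_small_int (m : nat) (Q : int -> R -> Prop) :
  (forall s, - m%:Z <= s <= m%:Z -> for_small (Q s)) ->
  for_small (fun e => forall s, - m%:Z <= s <= m%:Z -> Q s e).
Proof.
move=> h; pose f (k : 'I_(m + m).+1) := (k : nat)%:Z - m%:Z.
have : for_small (fun e => forall k, Q (f k) e).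
  by apply: for_small_fin => k; apply: h; rewrite /f; have := ltn_ord k; lia.
move/for_small_sub; apply => e _ hk s sm.
have km : (`|(s + m%:Z)%R| < (m + m).+1)%N by lia.
have := hk (Ordinal km); rewrite /f /= (_ : _ - _ = s) //; lia.
Qed.

End Small.

Section AffineSpan.
Variables (R : realType) (m n : nat) (A : set (set 'rV[R]_n)).
Hypothesis hA : A `<=` @catalan R n m.

(** Equalities at [x] persist along [v]; the finitely many other signs are strict and survive a
    small step. *)
Lemma cell_small (x v : 'rV[R]_n) :
  (forall i j (s : int), A (hyperplane i j s) ->
     x ord0 i - x ord0 j = s%:~R -> v ord0 i = v ord0 j) ->
  for_small (fun e => cell A x (x + e *: v)).
Proof.
move=> hv.
have : for_small (fun e => forall i j (s : int), - m%:Z <= s <= m%:Z -> A (hyperplane i j s) ->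
    Num.sg ((x + e *: v) ord0 i - (x + e *: v) ord0 j - s%:~R) = Num.sg (x ord0 i - x ord0 j - s%:~R)).
  apply: for_small_fin => i; apply: for_small_fin => j; apply: for_small_int => s _.
  have [e|ne] := eqVneq (x ord0 i - x ord0 j) s%:~R.
    exists 1 => // eps _ As; rewrite !mxE /=; have ev := hv _ _ _ As e.
    by congr Num.sg; rewrite ev; ring.
  rewrite -subr_eq0 in ne.
  apply: for_small_sub (for_small_sg (v ord0 i - v ord0 j) ne) _ => e _ <- _.
  by rewrite !mxE; congr Num.sg; ring.
by move/for_small_sub; apply => e _ h i j s As; apply: h => //; case: (hyperplane_catalan (hA As)).
Qed.

Lemma affine_span_cell (x : 'rV[R]_n) (V : {vspace 'rV[R]_n}) :
  (forall v, v \in V <-> forall i j (s : int), A (hyperplane i j s) ->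
     x ord0 i - x ord0 j = s%:~R -> v ord0 i = v ord0 j) ->
  affine_span (cell A x) = [set y | y - x \in V].
Proof.
move=> hV; apply/seteqP; split=> y /=.
  case=> k [a [p [hp a1 ->]]].
  have -> : \sum_(l < k) a l *: p l - x = \sum_(l < k) a l *: (p l - x).
    rewrite -[X in _ - X]scale1r -a1 scaler_suml -sumrB.
    by apply: eq_bigr => l _; rewrite scalerBr.
  apply: rpred_sum => l _; apply: rpredZ; apply/hV => i j s As e.
  have /sg_eq_eq0 := hp l i j s As.
  by rewrite e subrr eqxx !mxE => /eqP; lra.
move=> /hV hv; set v := y - x in hv.
have [e e0 he] : exists2 e, 0 < e & cell A x (x + e *: v).
  exact: for_small_ex (cell_small hv).
(* With [v = y - x], the point [y] is the affine combination of [x] and [x + e *: v] with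
   coefficients [1 - e^-1] and [e^-1]. *)
exists 2%N, (fun l => if l == ord0 then 1 - e^-1 else e^-1), (fun l => if l == ord0 then x else x + e *: v).
split.
- by move=> l; case: eqP => _ //; exact: cell_refl.
- by rewrite !big_ord_recl big_ord0 /= addr0 subrK.
- rewrite !big_ord_recl big_ord0 /= addr0 scalerDr scalerA mulVf ?gt_eqF // scale1r.
  by rewrite addrA -scalerDl subrK scale1r /v addrC subrK.
Qed.

End AffineSpan.

Section Codim.
Variables (R : realType) (m n : nat) (A : set (set 'rV[R]_n)).
Hypothesis hA : A `<=` @catalan R n m.
Variables (t : tree m n) (mu : edges n).
Hypothesis mt : is_marked_tree t mu.
Local Notation marked := (marked t mu).
Local Notation same_block := (same_block mu).
Local Notation P := (node_path t).

Lemma block_top a : exists2 k, ~~ marked k & same_block k a.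
Proof.
have [N] := ubnP (size (P a)); elim: N a => // N IH a sa.
case E: (marked a); last by exists a; rewrite ?E //; exact: connect0.
case/fintype.existsP: E => j /fintype.existsP[s /andP[cj mj]].
have [k nk kj] : exists2 k, ~~ marked k & same_block k j.
  by apply: IH; move: sa; move/eqP: cj => ->; rewrite size_rcons.
exists k => //; apply: same_block_trans kj _; apply: connect1.
by rewrite /= finset.setUC.
Qed.

Lemma block_top_uniq k k' : ~~ marked k -> ~~ marked k' -> same_block k k' -> k = k'.
Proof.
move=> nk nk' kk'; apply: (prefix_inj mt); apply: (unmarked_top mt) => //.
by rewrite same_block_sym.
Qed.

Lemma card_marked : #|mu| = #|[set i | marked i]%SET|.
Proof.
(* The edge above [i]; the default is reached only when [i] is unmarked. *)
pose e i := [set i; odflt i [pick j | [exists s, is_child t i j s && ([set i; j]%SET \in mu)]]]%SET.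
have eP i : marked i -> exists j s, [/\ is_child t i j s, [set i; j]%SET \in mu & e i = [set i; j]%SET].
  move=> /fintype.existsP[j0 h0]; rewrite /e; case: pickP => [j /fintype.existsP[s /andP[h1 h2]]|/(_ j0)].
    by exists j, s.
  by rewrite h0.
have muE : mu = (e @: [set i | marked i])%SET.
  apply/finset.setP => E; apply/idP/imsetP => [Emu|[i]]; last first.
    by rewrite inE => /eP[j [s [_ h ->]]] ->.
  case: mt => _ /(_ _ Emu) [i [j [s [[cij _] eE]]]] _; exists i.
    rewrite inE; apply/fintype.existsP; exists j; apply/fintype.existsP; exists s.
    by rewrite cij -eE.
  have mi : marked i.
    by apply/fintype.existsP; exists j; apply/fintype.existsP; exists s; rewrite cij -eE.
  have [j' [s' [cij' _ ->]]] := eP i mi.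
  by have [<- _] := child_parent_inj mt cij cij'.
rewrite {1}muE; apply: card_in_imset => i i'; rewrite !inE => /eP[j [s [ci _ ->]]] /eP[j' [s' [ci' _ ->]]] h.
have [[]//|[e1 e2]] := set2_eq (child_neq ci) h.
by subst; move: ci ci' => /eqP h1 /eqP/(congr1 size); rewrite size_rcons h1 size_rcons; lia.
Qed.

(** By connectedness, the direction space consists of the vectors constant on blocks. Each block has
    exactly one unmarked node, its top, so the indicator vectors of blocks form a basis indexed by
    the unmarked nodes. *)
Lemma tree_codim : arr_connected A t mu -> has_codim (cell A (tree_point R t mu)) #|mu|.
Proof.
move=> conn; pose U := [set k | ~~ marked k]%SET.
pose blk k : 'rV[R]_n := \row_i (if same_block k i then 1 else 0).
pose Y : #|U|.-tuple 'rV[R]_n := [tuple blk (enum_val i) | i < #|U|].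
have YE (i : 'I_#|U|) : Y`_i = blk (enum_val i) by rewrite -tnth_nth tnth_mktuple.
have evU (l : 'I_#|U|) : ~~ marked (enum_val l) by have := enum_valP l; rewrite inE.
have blkE (l l' : 'I_#|U|) : same_block (enum_val l) (enum_val l') = (l == l').
  apply/idP/eqP => [h|->]; last exact: connect0.
  by apply/enum_val_inj/block_top_uniq.
have sumE (c : 'I_#|U| -> R) l a : same_block (enum_val l) a ->
    (\sum_(l < #|U|) c l *: Y`_l) ord0 a = c l.
  move=> la; rewrite summxE (bigD1 l) //= big1 => [|l' neq].
    by rewrite YE !mxE la mulr1 addr0.
  rewrite YE !mxE; case E: (same_block _ _); last by rewrite mulr0.
  rewrite -(blkE l' l) in neq; case/negP: neq; apply: same_block_trans E _.
  by rewrite same_block_sym.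
have freeY : free Y.
  apply/freeP => c c0 l; rewrite -(sumE c l (enum_val l)) ?c0 ?mxE //; exact: connect0.
have topE a : exists l : 'I_#|U|, same_block (enum_val l) a.
  have [k nk ka] := block_top a; have kU : k \in U by rewrite inE.
  by exists (enum_rank_in kU k); rewrite enum_rankK_in.
have hV v : v \in <<Y>>%VS <-> forall a b, same_block a b -> v ord0 a = v ord0 b.
  split=> [/coord_span -> a b ab|h].
    have [l la] := topE a; rewrite (sumE _ l) // (sumE _ l) //.
    exact: same_block_trans la ab.
  have -> : v = \sum_(l < #|U|) v ord0 (enum_val l) *: Y`_l.
    apply/rowP => a; have [l la] := topE a.
    by rewrite (sumE (fun l => v ord0 (enum_val l)) l) // (h _ _ la).
  by apply: rpred_sum => l _; apply/rpredZ/memv_span/mem_nth; rewrite size_tuple.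
exists #|U|; last first.
  have := cardsC [set i | marked i]%SET; rewrite card_ord -card_marked.
  by rewrite (_ : ~: _ = U)%SET => [|]; [lia|apply/finset.setP => i; rewrite !inE].
exists (tree_point R t mu), <<Y>>%VS; split; last first.
  by move: freeY; rewrite /free size_tuple => /eqP.
apply: (affine_span_cell hA) => v; rewrite hV; split=> [h i j s As|h a b ab].
  by move=> /(tree_point_int mt)[/h].
apply/eqP; rewrite -subr_eq0 -[0](subrr (0 : R)); apply/eqP.
apply: (connect_diff (f := v ord0) (g := fun=> 0)) (arr_connectedE mt conn ab) => c d /and3P[/asboolP Acd cd _].
rewrite (h _ _ _ Acd) ?subrr //; exact: tree_point_same.
Qed.

End Codim.

(** * Injectivity *)

Section Transitivity.
Variables (R : realType) (n : nat) (A : set (set 'rV[R]_n)).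
Hypothesis hst : strongly_transitive A.

Lemma strongly_transitive_int (a b c : 'I_n) (p q r : int) :
  a != b -> b != c -> a != c -> 0 <= p -> 0 <= q -> r = p + q ->
  ~ A (hyperplane a b p) -> ~ A (hyperplane b c q) -> ~ A (hyperplane a c r).
Proof.
by case: p q => // p [] // q ab bc ac _ _ -> h1 h2; exact: (hst ab bc ac h1 h2).
Qed.
End Transitivity.

Lemma child_path m n (t : tree m n) (i j : 'I_n) (s : 'I_m.+1) :
  is_child t i j s -> node_path t i = rcons (node_path t j) s.
Proof. by move/eqP. Qed.

Lemma exists_cadet m n (t : tree m n) (k c : 'I_n) (u : 'I_m.+1) : is_mn_tree t ->
  is_child t k c u -> exists k' u', is_cadet t k' c u' /\ (u <= u')%N.
Proof.
move=> tT ck; have h0 : [exists k, is_child t k c u] by apply/fintype.existsP; exists k.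
case: (arg_maxnP (P := fun x => [exists k, is_child t k c x]) (fun x : 'I_m.+1 => x : nat) h0).
move=> x /fintype.existsP[k' hk'] hmax; exists k', x; split; last exact: hmax.
split=> // y xy; apply/(child_leafP tT) => l el.
have : (y <= x)%N by apply: hmax; apply/fintype.existsP; exists l; rewrite /is_child el.
by rewrite leqNgt xy.
Qed.

(** * Comparing two trees with the same cell *)

Section Transfer.
Variables (R : realType) (m n : nat) (A : set (set 'rV[R]_n)).
Variables (t t' : tree m n) (mu mu' : edges n).
Hypotheses (mt : is_marked_tree t mu) (mt' : is_marked_tree t' mu').
Hypotheses (conn : arr_connected A t mu).
Hypothesis sgX : cell A (tree_point R t mu) (tree_point R t' mu').
Implicit Types (a b c d i j k : 'I_n).

(** A block is generated by hyperplanes of [A] through the tree point, and two points of one cell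
    lie on the same hyperplanes of [A]. *)
Lemma same_block_transfer a b : same_block mu a b ->
  same_block mu' a b /\
  (drift t a)%:Z - (drift t b)%:Z = (drift t' a)%:Z - (drift t' b)%:Z.
Proof.
move=> /(arr_connectedE mt conn) ab.
have edge c d : arr_edge A t mu c d -> same_block mu' c d /\
    (drift t c)%:Z - (drift t d)%:Z = (drift t' c)%:Z - (drift t' d)%:Z.
  case/and3P => /asboolP Acd cd _; apply: (tree_point_int mt' (R := R)).
  have /sg_eq_eq0 := sgX Acd; rewrite (tree_point_same R mt cd) subrr eqxx.
  by rewrite subr_eq0 => /eqP.
split; first by apply: connect_sub ab => c d /edge[].
by apply: (connect_diff (f := fun i => (drift t i)%:Z) (g := fun i => (drift t' i)%:Z)) ab => c d /edge[].
Qed.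

Lemma prefix_transfer a b : same_block mu a b ->
  prefix (node_path t a) (node_path t b) = prefix (node_path t' a) (node_path t' b).
Proof.
move=> ab; have [ab' e] := same_block_transfer ab.
by rewrite (block_prefixE mt ab) (block_prefixE mt' ab'); lia.
Qed.

End Transfer.

Section Transfer2.
Variables (R : realType) (m n : nat) (A : set (set 'rV[R]_n)).
Variables (t t' : tree m n) (mu mu' : edges n).
Hypotheses (mt : is_marked_tree t mu) (mt' : is_marked_tree t' mu').
Hypotheses (conn : arr_connected A t mu) (conn' : arr_connected A t' mu').
Hypothesis sgX : cell A (tree_point R t mu) (tree_point R t' mu').
Implicit Types (a b c d i j k : 'I_n).

Let sgX' : cell A (tree_point R t' mu') (tree_point R t mu).
Proof. by rewrite (cell_eq sgX). Qed.

(** The ends of a marked edge are consecutive in their block, and the block has the same ancestor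
    order in both trees. Hence the parent of [i] in [t'], being in the block, is again [j]. *)
Lemma marked_child_transfer i j (s : 'I_m.+1) : is_child t i j s ->
  [set i; j]%SET \in mu -> is_child t' i j s.
Proof.
move=> cij mij; have [ij dij] := marked_child_same mij cij.
have [ij' e] := same_block_transfer mt mt' conn sgX ij.
have ji : same_block mu j i by rewrite same_block_sym.
have /eqP Pi := cij.
have pji : prefix (node_path t' j) (node_path t' i).
  by rewrite -(prefix_transfer mt mt' conn sgX ji) Pi prefix_rcons.
have nji : j != i by rewrite eq_sym (child_neq cij).
have [b [s' [cb pjb]]] := prefix_strict mt' pji nji.
have pbi : prefix (node_path t' b) (node_path t' i) by move/eqP: cb => ->; rewrite prefix_rcons.
have ji' : same_block mu' j i by rewrite same_block_sym.
have jb' := block_between mt' ji' pjb pbi.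
have [jb _] := same_block_transfer mt' mt conn' sgX' jb'.
have bi : same_block mu b i by apply: same_block_trans ji; rewrite same_block_sym.
have : prefix (node_path t b) (node_path t i) by rewrite (prefix_transfer mt mt' conn sgX bi).
rewrite Pi prefix_rconsE => /orP[|pbj].
  rewrite -/(child_vertex t j s) -Pi => /eqP ebi; have [tT _ _] := mt.
  by have := child_neq cb; rewrite (node_path_inj tT ebi) eqxx.
have ejb : b = j.
  by apply: (prefix_inj mt) => //; rewrite (prefix_transfer mt mt' conn sgX jb).
subst b; suff -> : s = s' by [].
apply: val_inj => /=; have : drift t' i = (drift t' j + s')%N.
  by rewrite /drift (child_path cb) vdrift_rcons.
by move: e dij; clear; lia.
Qed.

Lemma marked_transfer i : marked t mu i -> marked t' mu' i.
Proof.
case/fintype.existsP => j /fintype.existsP[s /andP[cij mij]].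
apply/fintype.existsP; exists j; apply/fintype.existsP; exists s.
have cij' := marked_child_transfer cij mij; rewrite cij' /=.
apply: (marked_child mt' cij'); rewrite same_block_sym.
by have [] := same_block_transfer mt mt' conn sgX (connect1 mij).
Qed.

End Transfer2.

Section Uniqueness.
Variables (R : realType) (m n : nat) (A : set (set 'rV[R]_n)).
Hypothesis hst : strongly_transitive A.
Variables (t t' : tree m n) (mu mu' : edges n).
Hypotheses (mt : is_marked_tree t mu) (mt' : is_marked_tree t' mu').
Hypotheses (conn : arr_connected A t mu) (conn' : arr_connected A t' mu').
Hypothesis cad' : cadet_condition A t' mu'.
Hypothesis sgX : cell A (tree_point R t mu) (tree_point R t' mu').
Implicit Types (a b c d e f i j k : 'I_n).
Local Notation P := (node_path t).
Local Notation P' := (node_path t').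
Local Notation X := (tree_point R t mu).
Local Notation X' := (tree_point R t' mu').
Local Notation off' := (offset R t' mu').

Let sgX' : cell A X' X.
Proof. by rewrite (cell_eq sgX). Qed.

Let tT : is_mn_tree t. Proof. by case: mt. Qed.
Let tT' : is_mn_tree t'. Proof. by case: mt'. Qed.

Variable i : 'I_n.
Hypothesis PP'i : P i <> P' i.
Hypothesis Pmin : forall k, P k <> P' k -> preceq (P i) (P k) /\ preceq (P i) (P' k).

(** Were the edge above [i] marked, [i] would be the same child of the same [j] in both trees; as
    [j] comes earlier, it has the same place in both, and then so has [i]. *)
Lemma minimal_unmarked : ~~ marked t' mu' i.
Proof.
have um : ~~ marked t mu i.
  apply/negP => /fintype.existsP[j /fintype.existsP[s /andP[cij mij]]].
  have cij' := marked_child_transfer mt mt' conn conn' sgX cij mij.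
  have [ePj|/eqP/Pmin[h _]] := eqVneq (P j) (P' j).
    by case: PP'i; move/eqP: cij => ->; move/eqP: cij' => ->; rewrite /child_vertex ePj.
  by have := prec_rcons (P j) s; rewrite -(child_path cij) precNge h.
by apply: contra um; apply: (marked_transfer mt' mt conn' conn sgX').
Qed.

(* Invariant of the climb from [i] towards the root of [t']. *)
Definition chain_ancestor d : Prop :=
  [/\ prefix (P' d) (P' i), drift t' d = drift t' i, ~~ marked t' mu' d &
      d = i \/ [/\ (i < d)%N, ~ A (hyperplane d i 0) & forall e, same_block mu' e d -> e = d]].

(** * One step of the climb, from [d] to its parent [c] *)

Section Step.
Variables (d c : 'I_n) (u : 'I_m.+1).
Hypotheses (hd : chain_ancestor d) (dc : is_child t' d c u) (pd : prec (P i) (P' d)).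

Let ddc : drift t' d = (drift t' c + u)%N.
Proof. by move/eqP: dc; rewrite /drift => ->; rewrite vdrift_rcons. Qed.

Let di : drift t' i = (drift t' c + u)%N.
Proof. by case: hd => _ <- _ _; exact: ddc. Qed.

Let pcd : prefix (P' c) (P' d).
Proof. by move/eqP: dc => ->; rewrite prefix_rcons. Qed.

Let pci : prefix (P' c) (P' i).
Proof. by case: hd => + _ _ _; apply: prefix_trans. Qed.

Let um_d : ~~ marked t' mu' d. Proof. by case: hd. Qed.

Let ncd : ~~ same_block mu' c d.
Proof.
apply: contra um_d => /(marked_child mt' dc) h.
by apply/fintype.existsP; exists c; apply/fintype.existsP; exists u; rewrite dc.
Qed.

Let nci : ~~ same_block mu' c i.
Proof.
by apply: contra ncd => ci; apply: (block_between mt' ci pcd); case: hd.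
Qed.

Let neq_ci e : same_block mu' e c -> e != i.
Proof.
move=> ec; apply/eqP => ei; subst e; case/negP: nci; by rewrite same_block_sym.
Qed.

Let nci_t : ~~ same_block mu i c.
Proof.
by apply: contra nci; rewrite same_block_sym => /(same_block_transfer mt mt' conn sgX)[].
Qed.

(** If [c] has the same place in both trees, its [u]-child is the vertex [P' d], which comes after
    [P i]. Otherwise [P c] already comes at or after [P i] by minimality. *)
Let Xlt : X ord0 i - X ord0 c < (u : nat)%:R.
Proof.
rewrite -(prec_child_point R mt) //.
have [ePc|/eqP/Pmin[h _]] := eqVneq (P c) (P' c).
  by move/eqP: dc pd; rewrite /child_vertex ePc => ->.
apply: preceq_prec_trans h _; exact: prec_rcons.
Qed.

Let transfer_diff a b : same_block mu' a b ->
  X ord0 a - X ord0 b = (drift t' a)%:R - (drift t' b)%:R.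
Proof.
move=> /(same_block_transfer mt' mt conn' sgX')[ab e].
by rewrite (tree_point_same R mt ab) -e rmorphB /= -!pmulrn.
Qed.

Let diR : (drift t' i)%:R = (drift t' c)%:R + (u : nat)%:R :> R.
Proof. by rewrite di natrD. Qed.

(* The block of [i] lies below that of [c] shifted by [u] in [X] and above it in
   [X'], so no hyperplane of [A] can see the exact relative position. *)
Let not_in_A a b : same_block mu' a i -> same_block mu' b c ->
  ~ A (drift_hyperplane t' a b).
Proof.
move=> ai bc Aab; have /sg_eq_gt0 := sgX Aab.
have := transfer_diff ai; have := transfer_diff bc.
rewrite !(tree_pointE R t' mu') (offset_same R mt' ai) (offset_same R mt' bc).
have := offset_prefix_lt R mt' pci nci; have := Xlt; have := diR.
rewrite rmorphB /= -!pmulrn => h1 h2 h3 h4 h5.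
have -> : 0 < (drift t' a)%:R + off' i - ((drift t' b)%:R + off' c)
   - ((drift t' a)%:R - (drift t' b)%:R) by lra.
by move/esym; lra.
Qed.

(* Otherwise [i] would cut the block of [c] in two, and by transitivity no
   hyperplane of [A] would link the two parts. *)
Lemma chain_last (k : 'I_n) (s : 'I_m.+1) : is_child t' k c s -> [set k; c]%SET \notin mu'.
Proof.
move=> ck; apply/negP => mk.
have us : (u < s)%N.
  rewrite ltn_neqAle (cadet_max mt' (marked_child_cadet mt' ck mk) dc) andbT.
  apply/eqP => /val_inj e; subst s; case/negP: um_d.
  have -> : d = k by apply: (node_path_inj tT'); move/eqP: dc => ->; move/eqP: ck => ->.
  by apply/fintype.existsP; exists c; apply/fintype.existsP; exists u; rewrite ck.
have [kc dk] := marked_child_same mk ck; rewrite same_block_sym in kc.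
have Sc : (drift t' c <= drift t' i)%N by rewrite di leq_addr.
have Sk : ~~ (drift t' k <= drift t' i)%N by rewrite dk di -ltnNge ltn_add2l.
(* In its block, [c] has drift at most that of [i] and [k] has a larger one, so some hyperplane of
   [A] joins the two levels; it factors through [i]. *)
have [e [f [Aef Se Sf [ce cf]]]] :=
  connect_cut (S := fun x => (drift t' x <= drift t' i)%N) (arr_connectedE mt' conn' kc) Sc Sk.
have sub x y : connect (arr_edge A t' mu') x y -> same_block mu' x y.
  by apply: connect_sub => x' y' /and3P[].
have ec : same_block mu' e c by rewrite same_block_sym; exact: sub.
have fc : same_block mu' f c by rewrite same_block_sym; exact: sub.
have ii : same_block mu' i i by exact: connect0.
have /and3P[/asboolP Aef' _ nef] := Aef.
have h1 := not_in_A ii ec; have h2 := not_in_A ii fc.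
rewrite /drift_hyperplane hyperplane_sym in h2; rewrite /drift_hyperplane hyperplane_sym in Aef'.
apply: (strongly_transitive_int hst _ _ _ _ _ _ h2 h1 Aef'); rewrite ?neq_ci //.
- by rewrite eq_sym neq_ci.
- by rewrite eq_sym.
- by move: Sf; clear; lia.
- by move: Se; clear; lia.
- by clear; lia.
Qed.

Let block_c_le c' : same_block mu' c' c ->
  prefix (P' c') (P' c) /\ (drift t' c' <= drift t' c)%N.
Proof.
move=> h; have p := block_last mt' chain_last h; split=> //; exact: vdrift_prefix.
Qed.

Let ii : same_block mu' i i. Proof. exact: connect0. Qed.

(** A node at an index above [u] would yield an unmarked cadet [k] of positive index, and the cadet
    condition would link its block to that of [c] by a hyperplane of [A]. That hyperplane factors
    through [i], with neither factor in [A]. *)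
Lemma chain_cadet : is_cadet t' d c u.
Proof.
split=> // u2 uu2; apply/(child_leafP tT') => k0 ek0.
have ck0 : is_child t' k0 c u2 by rewrite /is_child ek0.
have [k [u' [ck uu']]] := exists_cadet tT' ck0; have {uu2 uu'}uu' := leq_trans uu2 uu'.
have [ck1 _] := ck; have mk := chain_last ck1.
have umk : ~~ marked t' mu' k.
  apply: contra mk => /fintype.existsP[c1 /fintype.existsP[u1 /andP[ck2 mk]]].
  by have [->] := child_parent_inj mt' ck1 ck2.
have dk : drift t' k = (drift t' c + u')%N.
  by move/eqP: ck1; rewrite /drift => ->; rewrite vdrift_rcons.
case: (cad' ck mk) => [[u0]|]; first by move: uu'; rewrite u0.
case=> k' [c' [/(same_blockP mt') kk' /(same_blockP mt') cc' Akc]].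
have [pcc' dc'] := block_c_le cc'.
have kk'' : same_block mu' k k' by rewrite same_block_sym.
have dk' : (drift t' k <= drift t' k')%N.
  by apply: vdrift_prefix; exact: (unmarked_top mt').
have nkc : ~~ same_block mu' c k.
  apply: contra mk => h; exact: (marked_child mt' ck1 h).
have pck : prefix (P' c) (P' k) by move/eqP: ck1 => ->; rewrite prefix_rcons.
(* The hyperplane [Akc] places [k] above the shifted block of [c] in [X], and [Xlt] places [i] below
   it, so [k] is above [i] relative to the drifts. In [X'] the offset of [k] is smaller than that of
   [i], so a hyperplane of [A] would see opposite signs. *)
have nAki : ~ A (drift_hyperplane t' k' i).
  move=> Aki; have /sg_eq_gt0 := sgX Aki; have /sg_eq_gt0 := sgX Akc.
  rewrite !(tree_pointE R t' mu') (offset_same R mt' kk') (offset_same R mt' cc').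
  have h0 := offset_prefix_lt R mt' pck nkc.
  have h1 : off' k < off' i.
    apply: (@lt_le_trans _ _ (off' d)); last by apply: offset_prefix; case: hd.
    apply: (offset_div R mt' (p := P' c) (s := u') (u := u) (v := [::]) (w := [::])) => //.
      by rewrite cats1; move/eqP: ck1 => ->.
    by rewrite cats1; move/eqP: dc => ->.
  have := transfer_diff cc'; have := Xlt; have := diR.
  rewrite !rmorphB /= -!pmulrn => h2 h3 h4.
  have -> : (0 < (drift t' k')%:R + off' k - ((drift t' c')%:R + off' c)
     - ((drift t' k')%:R - (drift t' c')%:R)) = true by lra.
  have -> : (0 < (drift t' k')%:R + off' k - ((drift t' i)%:R + off' i)
     - ((drift t' k')%:R - (drift t' i)%:R)) = false by lra.
  by move=> /esym h5 /esym; lra.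
have nkk : k' != i by apply/eqP => e; move: dk' dk di uu'; rewrite e; clear; lia.
apply: (strongly_transitive_int hst nkk _ _ _ _ _ nAki (not_in_A ii cc') Akc).
- by rewrite eq_sym neq_ci.
- by apply/eqP => e; move: dk' dk uu' dc'; rewrite e; clear; lia.
- by move: dk' dk di uu'; clear; lia.
- by move: di dc'; clear; lia.
- by clear; lia.
Qed.

(** The cadet condition at the unmarked edge leaves only this alternative: a hyperplane of [A]
    between the two blocks is excluded by [not_in_A] if [d = i], and otherwise factors through [i]
    because [d] is alone in its block. *)
Lemma chain_zero : u = ord0 /\ (d < c)%N.
Proof.
have mdc : [set d; c]%SET \notin mu'.
  apply: contra um_d => h.
  by apply/fintype.existsP; exists c; apply/fintype.existsP; exists u; rewrite dc.
case: (cad' chain_cadet mdc) => // -[d' [c' [/(same_blockP mt') dd' /(same_blockP mt') cc' Adc]]].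
case: hd => pdi edi _ [e|[id nA sing]].
  by subst d; case: (not_in_A dd' cc').
rewrite (sing _ dd') in Adc; have [pcc' dc'] := block_c_le cc'; exfalso.
apply: (strongly_transitive_int hst _ _ _ _ _ _ nA (not_in_A ii cc') Adc).
- by apply/eqP => e; subst; rewrite ltnn in id.
- by rewrite eq_sym neq_ci.
- apply/eqP => e; subst c'; move: (size_prefix pcc').
  by move/eqP: dc => ->; rewrite size_rcons ltnn.
- by [].
- by move: di dc'; clear; lia.
- by move: edi; clear; lia.
Qed.

Lemma chain_up : [/\ chain_ancestor c, preceq (P i) (P' c) & (size (P' c) < size (P' d))%N].
Proof.
have [u0 ltdc] := chain_zero.
have sz : (size (P' c) < size (P' d))%N by move/eqP: dc => ->; rewrite size_rcons.
have nAci : ~ A (hyperplane c i 0).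
  have := not_in_A ii (connect0 _ c).
  by rewrite /drift_hyperplane hyperplane_sym di u0 addn0 subrr oppr0.
(* A hyperplane of [A] from [c] to another [f] of its block would factor through [i], since [c] and
   [i] have equal drift and [f] has no larger one. *)
have sing e : same_block mu' e c -> e = c.
  move=> ec; apply/eqP; apply: contraT => nec.
  have ce : same_block mu' c e by rewrite same_block_sym.
  have [e1 [f [Aef /eqP Se Sf [_ cf]]]] :=
    connect_cut (S := pred1 c) (arr_connectedE mt' conn' ce) (eqxx c) nec.
  subst e1; have /and3P[/asboolP Acf scf ncf] := Aef.
  have fc : same_block mu' f c by rewrite same_block_sym.
  have [_ dfc] := block_c_le fc.
  exfalso; apply: (strongly_transitive_int hst _ _ ncf _ _ _ nAci (not_in_A ii fc) Acf) => //.
  - by apply: neq_ci; exact: connect0.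
  - by rewrite eq_sym neq_ci.
  - by move: di dfc; rewrite u0; clear; lia.
  - by move: di; rewrite u0 /=; clear; lia.
split=> //; last first.
  by apply: prec_rcons0; move: pd; move/eqP: dc => ->; rewrite u0.
split=> //.
- by rewrite di u0 addn0.
- apply/negP => /fintype.existsP[c2 /fintype.existsP[s2 /andP[cc2 mc2]]].
  have := sing c2; rewrite same_block_sym => /(_ (connect1 mc2)) e.
  by have := child_neq cc2; rewrite e eqxx.
- right; split=> //; case: hd => _ _ _ [e|[id _ _]]; first by rewrite -e.
  exact: ltn_trans id ltdc.
Qed.

End Step.

(** The climb shortens [P' d] while keeping it at or after [P i]. The root is the first vertex, so
    the climb must hit [P i], and not at [d = i] because [i] is displaced. *)
Lemma minimal_replaced : exists2 c, P' c = P i & (i < c)%N.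
Proof.
have Qi : chain_ancestor i.
  by split=> //; [exact: prefix_refl|exact: minimal_unmarked|left].
have [_ pi] := Pmin PP'i.
suff H N d : (size (P' d) < N)%N -> chain_ancestor d -> preceq (P i) (P' d) ->
    exists2 c, P' c = P i & (i < c)%N by exact: (H _ _ (ltnSn _) Qi pi).
elim: N d => // N IH d sd hd.
case/orP => [/eqP e|pd].
  exists d => //; case: hd => _ _ _ [ei|[]] //.
  by subst d; case: PP'i.
have [e|[v [s e]]] : P' d = [::] \/ exists v s, P' d = rcons v s.
- by case: (lastP (P' d)) => [|v s]; [left|right; exists v, s].
- by rewrite e prec_nil in pd.
have [c ec] := node_path_parent tT' e.
have dc : is_child t' d c s by rewrite /is_child e /child_vertex ec.
have [hc pc sz] := chain_up hd dc pd.
by apply: IH hc pc; apply: leq_trans sz _; rewrite -ltnS.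
Qed.

End Uniqueness.

Lemma marked_trees_eq (R : realType) (m n : nat) (A : set (set 'rV[R]_n))
    (t t' : tree m n) (mu mu' : edges n) :
  strongly_transitive A -> marked_trees A (t, mu) -> marked_trees A (t', mu') ->
  cell A (tree_point R t mu) (tree_point R t' mu') -> (t, mu) = (t', mu').
Proof.
move=> hst [/= mt conn cad] [/= mt' conn' cad'] sgX.
have sgX' : cell A (tree_point R t' mu') (tree_point R t mu) by rewrite (cell_eq sgX).
have tT : is_mn_tree t by case: mt.
have tT' : is_mn_tree t' by case: mt'.
have PP : node_path t =1 node_path t'.
  move=> i0; apply/eqP; apply: contraT => ne0.
  (* The minimum is taken over the places of displaced nodes in either tree; the boolean tells in
     which. *)
  pose F (x : 'I_n * bool) := if x.2 then node_path t x.1 else node_path t' x.1.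
  pose D (x : 'I_n * bool) := node_path t x.1 != node_path t' x.1.
  have := @extremumP _ _ (@preceq m) (i0, true) D F (@preceq_refl m) (@preceq_trans m) (@preceq_total m) ne0.
  case=> -[i b] /= Di hmin.
  have h k : node_path t k <> node_path t' k ->
      preceq (F (i, b)) (node_path t k) /\ preceq (F (i, b)) (node_path t' k).
    by move=> /eqP ne; split; [exact: (hmin (k, true))|exact: (hmin (k, false))].
  rewrite /F /= in h; rewrite /D /= in Di; case: b h {hmin} => h.
    have [c ec ic] := minimal_replaced hst mt mt' conn conn' cad' sgX (elimN eqP Di) h.
    have nec : node_path t' c <> node_path t c.
      by rewrite ec => /(node_path_inj tT) e; rewrite e ltnn in ic.
    have [|d ed cd] := minimal_replaced hst mt' mt conn' conn cad sgX' nec.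
      by move=> k /nesym/h[h1 h2]; rewrite ec.
    move: ed; rewrite ec => /(node_path_inj tT) e; subst d.
    by have := ltn_trans ic cd; rewrite ltnn.
  have [|c ec ic] := minimal_replaced hst mt' mt conn' conn cad sgX' (nesym (elimN eqP Di)).
    by move=> k /nesym/h[].
  have nec : node_path t c <> node_path t' c.
    by rewrite ec => /(node_path_inj tT') e; rewrite e ltnn in ic.
  have [|d ed cd] := minimal_replaced hst mt mt' conn conn' cad' sgX nec.
    by move=> k /h[h1 h2]; rewrite ec.
  move: ed; rewrite ec => /(node_path_inj tT') e; subst d.
  by have := ltn_trans ic cd; rewrite ltnn.
have et : t = t' by exact: node_path_ext.
subst t'; congr pair; apply/finset.setP => e.
(* On one tree, the blocks determine the marks: an edge is marked exactly when its ends share a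
   block. *)
have sub (nu nu' : edges n) : is_marked_tree t nu -> is_marked_tree t nu' ->
    (forall a b, same_block nu a b -> same_block nu' a b) -> e \in nu -> e \in nu'.
  move=> h h' hs enu; case: (h) => _ /(_ _ enu) [i [j [s [[cij _] ee]]]] _.
  rewrite ee; apply: (marked_child h' cij); rewrite same_block_sym; apply: hs.
  by rewrite ee in enu; exact: connect1.
apply/idP/idP; apply: sub => // a b.
  by case/(same_block_transfer mt mt' conn sgX).
by case/(same_block_transfer mt' mt conn' sgX').
Qed.

(** * Surjectivity *)

Section PrecShift.
Variable m : nat.
Implicit Types (v w : vertex m) (t r x : 'I_m.+1).

Lemma vdrift_neq v w : (vdrift v < vdrift w)%N -> v != w.
Proof. by apply: contraTneq => ->; rewrite ltnn. Qed.

Lemma prec_drift v w : (vdrift v < vdrift w)%N -> prec v w.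
Proof. by move=> h; rewrite precE h vdrift_neq. Qed.

Lemma plex_ext w u v : plex (w ++ u :: v) w = false.
Proof. by rewrite -[X in plex _ X]cats0 plex_cat. Qed.

Lemma div_neq p s t v w : s != t -> p ++ s :: v != p ++ t :: w.
Proof. by move=> st; apply: contra st; rewrite eqseq_cat // eqseq_cons eqxx /= => /andP[]. Qed.

Lemma prec_rcons2 v w t r : prec v w -> (t <= r)%N -> prec (rcons v t) (rcons w r).
Proof.
move=> pvw tr; have [h|h|h] := ltngtP (vdrift v + t) (vdrift w + r).
- by apply: prec_drift; rewrite !vdrift_rcons.
- by move: pvw; rewrite precE; lia.
have tr' : t = r by apply: val_inj => /=; move: pvw; rewrite precE; lia.
subst r; move: pvw; rewrite !precE !vdrift_rcons -h ltnn eqxx /= (addIn h) ltnn eqxx /=.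
move=> /andP[neq lvw]; apply/andP; split; first by apply: contra neq => /eqP/rcons_inj[->].
case: (vertex_splitP v w) => [/prefixP[[|y u] ew]|u v' e|p s s' v' w' ev ew neq'].
- by rewrite ew cats0 eqxx in neq.
- move: h; rewrite ew vdrift_cat vdrift_cons => h.
  have y0 : (y : nat) = 0%N by move: h; clear; lia.
  rewrite -cats1 rcons_cat plex_cat /= y0 andbT; have [t0|//] := posnP t.
  by rewrite (_ : t = y) ?eqxx ?orbT //; apply: val_inj; rewrite /= t0.
- by rewrite e plex_ext in lvw.
- by move: lvw; rewrite ev ew !rcons_cat !plex_cat /= (negbTE neq') !andFb.
Qed.

(** Both child indices are lowered by [r], which leaves [w] itself on the right; in
    [prec_rcons_shift] they are lowered by [t], which leaves [v] on the left. *)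
Lemma preceq_rcons_shift v w t r x : (x + r = t)%N -> preceq (rcons v x) w ->
  prec (rcons v t) (rcons w r).
Proof.
move=> xr; rewrite preceqE vdrift_rcons => /orP[h|/andP[/eqP h lvw]].
  by apply: prec_drift; rewrite !vdrift_rcons; lia.
rewrite precE !vdrift_rcons (_ : (vdrift v + t)%N = (vdrift w + r)%N); last by lia.
rewrite ltnn eqxx /=.
case: (vertex_splitP v w) => [/prefixP[[|y u] ew]|u v' e|p s s' v' w' ev ew neq'].
- by move: lvw; rewrite ew -cats1 cats0 plex_ext.
- move: lvw; rewrite ew -!cats1 -catA !plex_cat /= => lvw; apply/andP; split.
    by rewrite eqseq_cat // eqxx eqseq_cons; case: u {ew h lvw} => //= *; rewrite andbF.
  rewrite andbT in lvw *; rewrite -!(inj_eq val_inj) /= in lvw *; lia.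
- by rewrite e rcons_cat plex_ext in lvw.
- move: lvw; rewrite ev ew !rcons_cat !plex_cat /= (negbTE neq') !andFb => ->.
  by rewrite div_neq.
Qed.

Lemma prec_rcons_shift v w t r x : (x + t = r)%N -> (t < r)%N -> prec v (rcons w x) ->
  prec (rcons v t) (rcons w r).
Proof.
move=> xt tr; rewrite precE vdrift_rcons => /andP[neq] /orP[h|/andP[/eqP h lvw]].
  by apply: prec_drift; rewrite !vdrift_rcons; lia.
rewrite precE !vdrift_rcons (_ : (vdrift v + t)%N = (vdrift w + r)%N); last by lia.
rewrite ltnn eqxx /=.
case: (vertex_splitP v w) => [/vdrift_prefix|u v' e|p s s' v' w' ev ew neq'].
- by lia.
- move: h lvw neq; rewrite e vdrift_cat vdrift_cons -cats1 plex_cat /= => h.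
  have ux : (u <= x)%N by lia.
  rewrite ltnNge ux /= => /andP[/eqP ->]; case: v' {e h} => // _.
  by rewrite eqxx.
- move: lvw; rewrite ev ew !rcons_cat !plex_cat /= (negbTE neq') !andFb => ->.
  by rewrite div_neq.
Qed.

End PrecShift.

(** * The tree obtained by sorting shifted coordinates *)

Section TreeOfPoint.
Variables (R : realType) (m n : nat) (z : 'I_n -> R).
Hypothesis zgen : forall (a b : 'I_n) (s : int), a != b -> - m%:Z <= s <= m%:Z ->
  z b + s%:~R != z a.
Implicit Types (a b i j k l : 'I_n) (t r s : 'I_m.+1).

Let val (p : 'I_n * 'I_m.+1) : R := z p.1 + (p.2 : nat)%:R.

Lemma val_pair_inj : injective val.
Proof.
move=> [k t] [l r]; rewrite /val /=; have [<-|kl] := eqVneq k l.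
  by move=> /addrI/eqP; rewrite eqr_nat => /eqP/val_inj ->.
have h := zgen (s := t%:Z - r%:Z) (a := l) (b := k); move=> e.
have : z k + (t%:Z - r%:Z)%:~R != z l.
  by apply: h; [rewrite eq_sym|have := ltn_ord t; have := ltn_ord r; lia].
by rewrite rmorphB /= -!pmulrn; move: e => /= e /eqP; case; lra.
Qed.

Lemma z_inj : injective z.
Proof.
move=> a b e; apply/eqP; apply: contraT => ab.
have := zgen (s := 0) ab; rewrite addr0 e eqxx; apply; lia.
Qed.

(** The parent rule: the largest [z j + s] below [z i] makes [i] the [s]-child of [j], and [i] is
    the root if there is none. *)
Definition is_pred p i : bool := (val p < z i) && [forall q, (val q < z i) ==> (val q <= val p)].

Lemma is_predP p i : reflect (val p < z i /\ forall q, val q < z i -> val q <= val p) (is_pred p i).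
Proof.
apply: (iffP andP) => -[h1 h2]; split=> //.
  by move=> q; move/forallP/(_ q)/implyP: h2; apply.
by apply/forallP => q; apply/implyP; apply: h2.
Qed.

Lemma pred_exists q i : val q < z i -> exists2 p, is_pred p i & val q <= val p.
Proof.
move=> h; case: (arg_maxP (P := fun q => val q < z i) val h) => p pi pm.
by exists p; [apply/is_predP|apply: pm].
Qed.

Lemma is_pred_inj_node p i j : is_pred p i -> is_pred p j -> i = j.
Proof.
move=> /is_predP[pi mi] /is_predP[pj mj]; apply: z_inj.
have v0 k : val (k, ord0) = z k by rewrite /val /= addr0.
case: (ltrgtP (z i) (z j)) => // h.
  by have := mj (i, ord0); rewrite v0 => /(_ h); lra.
by have := mi (j, ord0); rewrite v0 => /(_ h); lra.
Qed.

Lemma is_pred_inj p q i : is_pred p i -> is_pred q i -> p = q.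
Proof.
move=> /is_predP[pi mp] /is_predP[qi mq]; apply: val_pair_inj.
by apply/eqP; rewrite eq_le mq // mp.
Qed.

Lemma is_pred_lt p i : is_pred p i -> z p.1 < z i.
Proof. by move=> /is_predP[+ _]; apply: le_lt_trans; rewrite lerDl ler0n. Qed.

(** A parent has smaller [z], so any fuel above the rank of [i] gives the same path. *)
Fixpoint pred_path N i : vertex m :=
  if N is N'.+1 then
    if [pick p | is_pred p i] is Some p then rcons (pred_path N' p.1) p.2 else [::]
  else [::].

Let rank i := #|[set j | z j < z i]%SET|.

Let rank_lt i j : z i < z j -> (rank i < rank j)%N.
Proof.
move=> h; apply: proper_card; apply/properP; split.
  by apply/fintype.subsetP => k; rewrite !inE => /lt_trans; apply.
by exists i; rewrite !inE ?ltxx.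
Qed.

Lemma pred_path_stable N N' i : (rank i < N)%N -> (rank i < N')%N ->
  pred_path N i = pred_path N' i.
Proof.
elim: N N' i => // N IH [|N'] i //= hN hN'.
case: pickP => // p pi; have pl := rank_lt (is_pred_lt pi).
by rewrite (IH N') //; apply: leq_trans pl _.
Qed.

Definition point_path i := pred_path (rank i).+1 i.

Lemma point_path_pred p i : is_pred p i -> point_path i = rcons (point_path p.1) p.2.
Proof.
move=> pi; rewrite {1}/point_path /=; case: pickP => [q qi|/(_ p)]; last by rewrite pi.
rewrite (is_pred_inj qi pi); congr rcons; apply: pred_path_stable => //.
exact: rank_lt (is_pred_lt pi).
Qed.

Lemma point_path_nil i : (forall p, ~~ is_pred p i) -> point_path i = [::].
Proof. by move=> h; rewrite /point_path /=; case: pickP => // p; rewrite (negbTE (h p)). Qed.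

Lemma point_path_cases i : (point_path i = [::] /\ forall p, ~~ is_pred p i) \/
  exists2 p, is_pred p i & point_path i = rcons (point_path p.1) p.2.
Proof.
case: (pickP (fun p => is_pred p i)) => [p pi|h].
  by right; exists p => //; exact: point_path_pred.
have h' p : ~~ is_pred p i by rewrite h.
by left; split=> //; exact: point_path_nil.
Qed.

Lemma point_path_inj : injective point_path.
Proof.
move=> i; have [N] := ubnP (rank i); elim: N i => // N IH i hi j.
case: (point_path_cases i) (point_path_cases j) => [[-> ni]|[p pi ->]] [[-> nj]|[q qj ->]].
- move=> _; apply: z_inj; case: (ltrgtP (z i) (z j)) => // h.
    have [|p pj] := @pred_exists (i, ord0) j; first by rewrite /val addr0.
    by rewrite (negbTE (nj p)) in pj.
  have [|p pj] := @pred_exists (j, ord0) i; first by rewrite /val addr0.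
  by rewrite (negbTE (ni p)) in pj.
- by move/(congr1 size); rewrite size_rcons.
- by move/(congr1 size); rewrite size_rcons.
move=> /rcons_inj[e1 e2]; apply: (is_pred_inj_node pi).
suff -> : p = q by [].
rewrite [p]surjective_pairing e2 (IH _ _ _ e1) -?surjective_pairing //.
by apply: leq_trans (rank_lt (is_pred_lt pi)) _; rewrite -ltnS.
Qed.

Let vrank p := #|[set q | val q < val p]%SET|.

Let vrank_le p q : val p <= val q -> (vrank p <= vrank q)%N.
Proof.
by move=> h; apply/subset_leq_card/fintype.subsetP => r; rewrite !inE => /lt_le_trans; apply.
Qed.

Let vrank_lt p q : val p < val q -> (vrank p < vrank q)%N.
Proof.
move=> h; apply: proper_card; apply/properP; split.
  by apply/fintype.subsetP => k; rewrite !inE => /lt_trans; apply.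
by exists p; rewrite !inE ?ltxx.
Qed.

Let vpath (p : 'I_n * 'I_m.+1) := rcons (point_path p.1) p.2.

Let val0 k : val (k, ord0) = z k. Proof. by rewrite /val /= addr0. Qed.

(* Shifting both vertices by the same amount and passing to parents reduces the
   comparison to earlier vertices. *)
Lemma vertex_order p q : val p < val q -> prec (vpath p) (vpath q).
Proof.
have [N] := ubnP (vrank p + vrank q); elim: N p q => // N IH [k t] [l r] hN hpq.
have IH' p q : val p <= val (k, t) -> val q <= val (l, r) ->
    val p < val q -> (val p < val (k, t)) || (val q < val (l, r)) -> prec (vpath p) (vpath q).
  move=> h1 h2 pq h3; apply: IH pq; rewrite ltnS in hN; apply: leq_trans hN.
  have := vrank_le h1; have := vrank_le h2.
  by case/orP: h3 => /vrank_lt; lia.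
rewrite /vpath /=; have [ekl|kl] := eqVneq k l.
  subst l; have tr : (t < r)%N by move: hpq; rewrite /val /= ltrD2l ltr_nat.
  by apply: prec_drift; rewrite !vdrift_rcons ltn_add2l.
have lk0 : val (k, ord0) <= val (k, t) by rewrite val0 /val /= lerDl ler0n.
have ll0 : val (l, ord0) <= val (l, r) by rewrite val0 /val /= lerDl ler0n.
rewrite !val0 in lk0 ll0.
case: (ltrgtP (z k) (z l)) => hkl; last by rewrite (z_inj hkl) eqxx in kl.
  case: (leqP t r) => tr.
    apply: prec_rcons2 => //.
    have [|p pl le] := @pred_exists (k, ord0) l; first by rewrite val0.
    have /is_predP[pl1 _] := pl; rewrite (point_path_pred pl).
    move: le; rewrite le_eqVlt => /orP[/eqP/val_pair_inj <-|lt]; first exact: prec_rcons.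
    apply: prec_trans (prec_rcons _ ord0) _; apply: (IH' (k, ord0)) => //.
    - by rewrite val0.
    - exact: ltW (lt_le_trans pl1 ll0).
    - by rewrite (lt_le_trans pl1 ll0) orbT.
  have xm : (t - r < m.+1)%N by have := ltn_ord t; lia.
  pose x := Ordinal xm; have xr : (x + r = t)%N by rewrite /= subnK // ltnW.
  have vx : val (k, x) = val (k, t) - (r : nat)%:R.
    by rewrite /val /= natrB ?(ltnW tr) //; lra.
  have xl : val (k, x) < z l by rewrite vx; move: hpq; rewrite /val /=; lra.
  have [p pl le] := pred_exists xl; have /is_predP[pl1 _] := pl.
  apply: (preceq_rcons_shift xr); rewrite (point_path_pred pl).
  move: le; rewrite le_eqVlt => /orP[/eqP/val_pair_inj <-|lt]; first exact: preceq_refl.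
  rewrite /preceq; apply/orP; right; apply: (IH' (k, x)) => //.
  - by rewrite vx; have := ler0n R r; lra.
  - exact: ltW (lt_le_trans pl1 ll0).
  - by rewrite (lt_le_trans pl1 ll0) orbT.
have tr : (t < r)%N by move: hpq; rewrite /val /= -(ltr_nat R); lra.
have xm : (r - t < m.+1)%N by have := ltn_ord r; lia.
pose x := Ordinal xm; have xr : (x + t = r)%N by rewrite /= subnK // ltnW.
have vx : val (l, x) = val (l, r) - (t : nat)%:R.
  by rewrite /val /= natrB ?(ltnW tr) //; lra.
have [|p pk le] := @pred_exists (l, ord0) k; first by rewrite val0.
have /is_predP[pk1 _] := pk.
apply: (prec_rcons_shift xr tr); rewrite (point_path_pred pk).
apply: (IH' p (l, x)).
- exact: ltW (lt_le_trans pk1 lk0).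
- by rewrite vx; have := ler0n R t; lra.
- by rewrite vx; move: hpq pk1; rewrite /val /=; lra.
- by rewrite (lt_le_trans pk1 lk0).
Qed.

Lemma tree_of_point : exists t : tree m n, [/\ is_mn_tree t,
  forall i j s, is_child t i j s = is_pred (j, s) i &
  forall a b s, a != b -> prec (node_path t a) (child_vertex t b s) = (z a < z b + (s : nat)%:R)].
Proof.
have [|t tT tP] := exists_tree point_path_inj.
  move=> i v s e; case: (point_path_cases i) => [[e' _]|[p _ e']].
    by move/(congr1 size): e; rewrite e' size_rcons.
  by exists p.1; move: e; rewrite e' => /rcons_inj[].
exists t; split=> // [i j s|a b s ab].
  rewrite /is_child /child_vertex !tP; apply/eqP/idP => [e|/point_path_pred //].
  case: (point_path_cases i) => [[e' _]|[p pi e']].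
    by move/(congr1 size): e; rewrite e' size_rcons.
  move: e; rewrite e' => /rcons_inj[/point_path_inj <- <-].
  by rewrite -surjective_pairing.
rewrite /child_vertex !tP; case: (ltrgtP (z a) (z b + (s : nat)%:R)) => h.
- apply: prec_trans (prec_rcons _ ord0) _; apply: (@vertex_order (a, ord0) (b, s)).
  by rewrite val0.
- apply/negbTE; rewrite precNge negbK; have [p pa le] := @pred_exists (b, s) a h.
  rewrite (point_path_pred pa); move: le; rewrite le_eqVlt => /orP[/eqP/val_pair_inj <-|lt].
    exact: preceq_refl.
  by rewrite /preceq; apply/orP; right; exact: (@vertex_order (b, s)).
- have := zgen (s := (s : nat)%:Z) ab; rewrite -h eqxx; have := ltn_ord s.
  by move=> sm /(_ _)/negP; case=> //; lia.
Qed.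

End TreeOfPoint.

Lemma connect_within (T : finType) (e e' : rel T) a b :
  (forall c d, connect e a c -> e c d -> e' c d) -> connect e a b -> connect e' a b.
Proof.
move=> h /connectP[p pth ->]; elim/last_ind: p pth => [|p x IH]; first by rewrite connect0.
rewrite rcons_path last_rcons => /andP[pth ex]; apply: connect_trans (IH pth) (connect1 _).
by apply: h ex; apply/connectP; exists p.
Qed.

(** * Generic points and tie-breaking *)

Section Generic.
Variables (R : realType) (m n : nat) (A : set (set 'rV[R]_n)).
Hypothesis hA : A `<=` @catalan R n m.
Implicit Types (x y : 'rV[R]_n) (a b c i j k : 'I_n).

Definition eq_edge y : rel 'I_n := fun a b =>
  `[< exists s : int, A (hyperplane a b s) /\ y ord0 a - y ord0 b = s%:~R >].

Definition generic y : Prop := forall a b (s : int),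
  y ord0 a - y ord0 b = s%:~R -> connect (eq_edge y) a b.

Lemma eq_edge_sym y : symmetric (eq_edge y).
Proof.
move=> a b; apply/asboolP/asboolP => -[s [As e]]; exists (- s).
  by rewrite -hyperplane_sym rmorphN /= -e opprB.
by rewrite -hyperplane_sym rmorphN /= -e opprB.
Qed.

Lemma connect_eq_edge_sym y : symmetric (connect (eq_edge y)).
Proof. exact: sym_connect_sym (@eq_edge_sym y). Qed.

Lemma eq_edge_cell x y : cell A x y -> eq_edge y = eq_edge x.
Proof.
move=> h; apply/funext => a; apply/funext => b; rewrite /eq_edge; congr asbool.
apply/propext; split=> -[s [As e]]; exists s; split=> //; have /sg_eq_eq0 := h a b s As.
  by rewrite e subrr eqxx => /esym; rewrite subr_eq0 => /eqP.
by rewrite e subrr eqxx subr_eq0 => /eqP.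
Qed.

Lemma connect_eq_edge_int y a b : connect (eq_edge y) a b ->
  exists s : int, y ord0 a - y ord0 b = s%:~R.
Proof.
case/connectP => p pth ->; elim: p a pth => [|c p IH] a /=; first by exists 0; rewrite subrr.
case/andP => /asboolP[s [_ e]] /IH[s' e']; exists (s + s').
by rewrite -(subrKA (y ord0 c)) e e' rmorphD.
Qed.

Lemma between_not_int (z : int) (r : R) : z%:~R < r < (z + 1)%:~R -> forall s : int, r <> s%:~R.
Proof. by move=> h s e; move: h; rewrite e !ltr_int; lia. Qed.

(** The moved value stays strictly between two consecutive integers; if [r] is an integer, the sign
    of [c] tells which two. *)
Lemma for_small_not_int (r c : R) : c != 0 ->
  for_small (fun e => forall s : int, r + e * c <> s%:~R).
Proof.
move=> c0; pose f := Num.floor r.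
have f1 : f%:~R <= r by rewrite /f; exact: floor_le.
have f2 : r < (f + 1)%:~R by rewrite /f; exact: floorD1_gt.
have [e|ne] := eqVneq r f%:~R.
  case: (ltrgtP c 0) => [cn|cp|]; last by move/eqP: c0.
    have h : (f - 1)%:~R - r < 0 by rewrite e rmorphB /=; lra.
    apply: for_small_sub (for_small_lt (- c) h) _ => eps e0 h'.
    apply: (@between_not_int (f - 1)); rewrite subrK -e; apply/andP; split; first by lra.
    by have := pmulr_rlt0 c e0; rewrite cn; lra.
  apply: for_small_sub (for_small_lt c f2) _ => eps e0 h'.
  by apply: (@between_not_int f); rewrite h' andbT e ltrDl mulr_gt0.
have f3 : f%:~R < r by rewrite lt_neqAle eq_sym ne.
have f4 : - r < - f%:~R by rewrite ltrN2.
apply: for_small_sub (for_small_and (for_small_lt c f2) (for_small_lt (- c) f4)) _ => eps e0 [h1 h2].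
by apply: (@between_not_int f); rewrite h1 andbT; lra.
Qed.

Lemma exists_generic x : exists2 y, cell A x y & generic y.
Proof.
(* The index of the class representative is constant on each class and separates different
   classes. *)
pose v : 'rV[R]_n := \row_i (fingraph.root (eq_edge x) i : nat)%:R.
have rt a b : connect (eq_edge x) a b = (fingraph.root (eq_edge x) a == fingraph.root (eq_edge x) b).
  by rewrite root_connect //; exact: connect_eq_edge_sym.
have h1 : for_small (fun e => cell A x (x + e *: v)).
  apply: (cell_small hA) => i j s As e; rewrite !mxE; congr (nat_of_ord _)%:R; apply/eqP.
  by rewrite -rt; apply: connect1; apply/asboolP; exists s.
have h2 : for_small (fun e => forall a b, ~~ connect (eq_edge x) a b -> forall s : int,
    (x + e *: v) ord0 a - (x + e *: v) ord0 b <> s%:~R).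
  apply: for_small_fin => a; apply: for_small_fin => b.
  case E: (connect _ a b); first by exists 1.
  have c0 : v ord0 a - v ord0 b != 0.
    by rewrite !mxE subr_eq0 eqr_nat; move: E; rewrite rt => /negbT.
  apply: for_small_sub (for_small_not_int (x ord0 a - x ord0 b) c0) _ => e _ h _ s.
  by move=> h'; apply: (h s); rewrite -h' !mxE; ring.
have [e e0 [c1 c2]] := for_small_ex (for_small_and h1 h2).
exists (x + e *: v) => // a b s es; rewrite (eq_edge_cell c1).
by apply: contraT => /c2/(_ s es).
Qed.

(* Inside a block, equal values [y_k + t] are listed by increasing [(y_k, k)], as
   in [prec]; the perturbation direction [n y_k + k] realizes this order. *)
Lemma tie_break y : exists z : 'I_n -> R, forall a b (s : int), a != b -> - m%:Z <= s <= m%:Z ->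
  z b + s%:~R != z a /\
  (z b + s%:~R < z a) = (y ord0 b + s%:~R < y ord0 a) ||
    (y ord0 b + s%:~R == y ord0 a) && ((0 < s) || (s == 0) && (b < a)%N).
Proof.
have : for_small (fun e => forall a b (s : int), - m%:Z <= s <= m%:Z -> a != b ->
    let z k := y ord0 k + e * (n%:R * y ord0 k + (k : nat)%:R) in
    z b + s%:~R != z a /\
    (z b + s%:~R < z a) = (y ord0 b + s%:~R < y ord0 a) ||
      (y ord0 b + s%:~R == y ord0 a) && ((0 < s) || (s == 0) && (b < a)%N)).
  apply: for_small_fin => a; apply: for_small_fin => b; apply: for_small_int => s _.
  pose D := y ord0 a - y ord0 b - s%:~R.
  pose C := n%:R * (y ord0 a - y ord0 b) + ((a : nat)%:R - (b : nat)%:R).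
  have zE e : y ord0 a + e * (n%:R * y ord0 a + (a : nat)%:R) -
      (y ord0 b + e * (n%:R * y ord0 b + (b : nat)%:R) + s%:~R) = D + e * C.
    by rewrite /D /C; ring.
  have [D0|D0] := eqVneq D 0.
    exists 1 => // e /andP[e0 _] ab /=.
    have eC : C = (n%:Z * s + a%:Z - b%:Z)%:~R.
      rewrite /C (_ : y ord0 a - y ord0 b = s%:~R); last by move: D0; rewrite /D; lra.
      by rewrite !rmorphD rmorphN rmorphM /= -!pmulrn; ring.
    (* Since [|a - b| < n], the sign is that of [s], and labels decide only when [s = 0]. *)
    have Ci : (0 < n%:Z * s + a%:Z - b%:Z) = (0 < s) || (s == 0) && (b < a)%N.
      have := ltn_ord a; have := ltn_ord b; clear; nia.
    have Cn : n%:Z * s + a%:Z - b%:Z != 0.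
      have : nat_of_ord a <> b by move/val_inj/eqP; rewrite (negbTE ab).
      have [s1|[->|s1]] : s <= -1 \/ s = 0 \/ 1 <= s by clear; lia.
      - by have := ltn_ord a; have := ltn_ord b; move: s1; clear; nia.
      - by clear; lia.
      - by have := ltn_ord a; have := ltn_ord b; move: s1; clear; nia.
    have -> : (y ord0 b + s%:~R < y ord0 a) = false by move: D0; rewrite /D; lra.
    have -> : (y ord0 b + s%:~R == y ord0 a) = true by move: D0; rewrite /D; lra.
    rewrite -subr_gt0 eq_sym -subr_eq0 zE D0 add0r pmulr_rgt0 // mulf_eq0 (gt_eqF e0) /=.
    by rewrite eC intr_eq0 ltr0z.
  apply: for_small_sub (for_small_sg C D0) _ => e e0 h ab /=.
  rewrite eq_sym -subr_eq0 -subr_gt0 zE (sg_eq_eq0 h) (sg_eq_gt0 h); split=> //.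
  have -> : (y ord0 b + s%:~R == y ord0 a) = false.
    by apply/eqP => e'; move/eqP: D0; apply; rewrite /D -e'; ring.
  by rewrite orbF /D; lra.
case/for_small_ex => e _ h; exists (fun k => y ord0 k + e * (n%:R * y ord0 k + (k : nat)%:R)).
by move=> a b s ab sm; apply: h.
Qed.

End Generic.

Lemma range0 (m : nat) : - m%:Z <= 0 <= m%:Z.
Proof. by lia. Qed.

Lemma range_nat (m u : nat) : (u <= m)%N -> - m%:Z <= u%:Z <= m%:Z.
Proof. by lia. Qed.

Lemma range_ord (m : nat) (s : 'I_m.+1) : - m%:Z <= (s : nat)%:Z <= m%:Z.
Proof. by apply: range_nat; rewrite -ltnS. Qed.

Lemma range_sub (m u v : nat) : (u <= m)%N -> (v <= m)%N -> - m%:Z <= u%:Z - v%:Z <= m%:Z.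
Proof. by lia. Qed.

(** * The marked tree of a generic point *)

Section MarkedTreeOfPoint.
Variables (R : realType) (m n : nat) (A : set (set 'rV[R]_n)).
Hypothesis hA : A `<=` @catalan R n m.
Variable y : 'rV[R]_n.
Hypothesis ygen : generic A y.
Variable z : 'I_n -> R.
Hypothesis zP : forall (a b : 'I_n) (s : int), a != b -> - m%:Z <= s <= m%:Z ->
  z b + s%:~R != z a /\
  (z b + s%:~R < z a) = (y ord0 b + s%:~R < y ord0 a) ||
    (y ord0 b + s%:~R == y ord0 a) && ((0 < s) || (s == 0) && (b < a)%N).
Variable t : tree m n.
Hypothesis tT : is_mn_tree t.
Hypothesis tchild : forall (i j : 'I_n) (s : 'I_m.+1), is_child t i j s = is_pred z (j, s) i.
Hypothesis tprec : forall (a b : 'I_n) (s : 'I_m.+1), a != b ->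
  prec (node_path t a) (child_vertex t b s) = (z a < z b + (s : nat)%:R).
Implicit Types (a b c i j k : 'I_n).

Local Notation conn := (connect (eq_edge A y)).

Let zgen a b (s : int) : a != b -> - m%:Z <= s <= m%:Z -> z b + s%:~R != z a.
Proof. by move=> ab sm; case: (zP ab sm). Qed.

Let z_lt a b (s : int) : a != b -> - m%:Z <= s <= m%:Z -> z b + s%:~R < z a ->
  y ord0 b + s%:~R < y ord0 a \/ y ord0 b + s%:~R = y ord0 a /\ ((0 < s) || (s == 0) && (b < a)%N).
Proof.
move=> ab sm; case: (zP ab sm) => _ -> /orP[|/andP[/eqP]]; first by left.
by right.
Qed.

Let z_le a b (s : int) : a != b -> - m%:Z <= s <= m%:Z -> z b + s%:~R < z a ->
  y ord0 b + s%:~R <= y ord0 a.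
Proof. by move=> ab sm /(z_lt ab sm)[/ltW//|[-> _]]. Qed.

(** A path of equality edges from [a] to [b] crosses the level of [b] by an edge of length at most
    [m], whose lower end [e] satisfies [y_e + tau = y_b] with [tau] in [0;m]. The predecessor of [b]
    lies between this value and [z b], so it too satisfies [y_j + s = y_b], and genericity puts [j]
    in the class of [b]. *)
Lemma pred_in_block a b : conn a b -> z a < z b ->
  exists j (s : 'I_m.+1), [/\ is_pred z (j, s) b, y ord0 j + (s : nat)%:R = y ord0 b & conn b j].
Proof.
move=> ab lab; have nb : ~~ (z b < z b) by rewrite ltxx.
have [e [f [/asboolP[d [Ad ed]] /= Se Sf [ae _]]]] := connect_cut (S := fun c => z c < z b) ab lab nb.
have [ef /andP[d1 d2]] := hyperplane_catalan (hA Ad).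
have be : conn b e by apply: connect_trans ae; rewrite connect_eq_edge_sym.
have [tau etau] := connect_eq_edge_int be.
have neb : e != b by apply/eqP => h; rewrite h ltxx in Se.
have m0 := range0 m.
have yeb : y ord0 e <= y ord0 b.
  have := @z_le b e 0; rewrite !addr0 eq_sym neb m0; exact.
have ybf : y ord0 b <= y ord0 f.
  have [->//|nfb] := eqVneq f b; have := @z_le f b 0; rewrite !addr0 nfb m0 => h; apply: h => //.
  by rewrite lt_neqAle leNgt Sf andbT (inj_eq (z_inj zgen)) eq_sym.
have tau0 : 0 <= tau by rewrite -(ler0z R) -etau; lra.
have taum : tau <= m%:Z.
  suff : tau <= - d by move: d1; clear; lia.
  by rewrite -(ler_int R) rmorphN /= -ed -etau; lra.
case: tau tau0 taum etau => // tau _ taum etau.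
have tm : (tau < m.+1)%N by move: taum; clear; lia.
pose T := Ordinal tm.
have lt : z e + tau%:R < z b.
  have tau1 := range_nat (tm : (tau <= m)%N).
  have [_ /= ->] := @zP b e tau ltac:(by rewrite eq_sym) tau1.
  have -> : y ord0 e + tau%:~R = y ord0 b by rewrite -etau; ring.
  rewrite eqxx /=; case: (posnP tau) => [t0|tp]; last by rewrite ltz_nat tp orbT.
  have [_] := @zP b e 0 ltac:(by rewrite eq_sym) m0; rewrite !addr0 Se => /esym/orP[|/andP[_ ]].
    by move: etau; rewrite t0 /=; lra.
  by rewrite /= t0 eqxx => ->; rewrite !orbT.
have [[j s] pj le] := @pred_exists _ _ _ z (e, T) b lt; exists j, s.
have /is_predP[/= jb _] := pj; rewrite /= in le.
have njb : j != b by apply/eqP => h; subst; move: jb; rewrite -subr_gt0 opprD addrA subrr; have := ler0n R s; lra.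
have sm := range_ord s.
have h1 : y ord0 j + (s : nat)%:R <= y ord0 b.
  by apply: (z_le (s := (s : nat)%:Z)) => //; rewrite eq_sym.
have h2 : y ord0 b <= y ord0 j + (s : nat)%:R.
  have -> : y ord0 b = y ord0 e + tau%:R by rewrite (_ : tau%:R = tau%:~R) // -etau; ring.
  have [eje|nje] := eqVneq j e; first by subst j; move: le; rewrite !lerD2l.
  have dm := range_sub (tm : (tau <= m)%N) (ltn_ord s : (s <= m)%N).
  have ne := zgen nje dm; rewrite rmorphB /= -!pmulrn in ne.
  have : z e + (tau%:Z - (s : nat)%:Z)%:~R < z j.
    by rewrite lt_neqAle rmorphB /= -!pmulrn ne /=; move: le; lra.
  by move/(z_le nje dm); rewrite rmorphB /= -!pmulrn; lra.
have e1 : y ord0 j + (s : nat)%:R = y ord0 b by apply/eqP; rewrite eq_le h1.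
split=> //; apply: (ygen (s := (s : nat)%:Z)); rewrite -e1 -pmulrn; ring.
Qed.

Lemma child_conn i j (s : 'I_m.+1) : is_child t i j s -> conn i j ->
  y ord0 i = y ord0 j + (s : nat)%:R.
Proof.
rewrite tchild => pij cij; have lt := is_pred_lt pij.
have [|j' [s' [pij' e _]]] := @pred_in_block j i _ lt; first by rewrite connect_eq_edge_sym.
by have [-> ->] := is_pred_inj zgen pij pij'.
Qed.

Definition point_marks : edges n :=
  [set e | [exists i, [exists j, [exists s, [&& is_child t i j s, conn i j & e == [set i; j]%SET]]]]]%SET.

Lemma point_marksP e : reflect (exists i j s, [/\ is_child t i j s, conn i j & e = [set i; j]%SET])
  (e \in point_marks).
Proof.
rewrite inE; apply: (iffP fintype.existsP) => [[i /fintype.existsP[j /fintype.existsP[s]]]|[i [j [s [h1 h2 ->]]]]].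
  by case/and3P => h1 h2 /eqP ->; exists i, j, s.
exists i; apply/fintype.existsP; exists j; apply/fintype.existsP; exists s.
by rewrite h1 h2 eqxx.
Qed.

(** Let [k] be a [u]-child of [j] with [u > s]. Since [y_i + (u - s) = y_j + u <= y_k] and the shift
    [u - s] is positive, the tie-break puts [z i + (u - s)] below [z k]. It exceeds [z j + u], so
    [(j, u)] is not the predecessor of [k]. *)
Lemma conn_child_cadet i j (s : 'I_m.+1) : is_child t i j s -> conn i j -> is_cadet t i j s.
Proof.
move=> cij connij; split=> // u su; apply/(child_leafP tT) => k ek.
have {ek} ck : is_child t k j u by rewrite /is_child ek.
have yij := child_conn cij connij; have ij := child_neq cij.
have /is_predP[/= lij _] : is_pred z (j, s) i by rewrite -tchild.
have /is_predP[/= ljk maxk] : is_pred z (j, u) k by rewrite -tchild.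
have jk : k != j := child_neq ck.
have um : (u - s < m.+1)%N by have := ltn_ord u; clear; lia.
have us : (u - s)%N%:R = (u : nat)%:R - (s : nat)%:R :> R by rewrite natrB // ltnW.
have sm := range_nat (um : (u - s <= m)%N).
have uZ := range_ord u.
have usR : (s : nat)%:R < (u : nat)%:R :> R by rewrite ltr_nat.
have yk := z_le jk uZ ljk; rewrite -pmulrn in yk.
have nlt : ~~ (z i + (u - s)%N%:R < z k).
  by apply/negP => /(maxk (i, Ordinal um)) /=; rewrite us; lra.
have [eki|nki] := eqVneq k i; first by subst k; lra.
have [_] := zP nki sm; rewrite -pmulrn (negbTE nlt) us.
move/esym/negbT; rewrite negb_or => /andP[h1].
have -> : (y ord0 i + ((u : nat)%:R - (s : nat)%:R) == y ord0 k) by lra.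
by rewrite /=; move: su; clear; lia.
Qed.

Lemma point_marked_tree : is_marked_tree t point_marks.
Proof.
split=> // [e /point_marksP[i [j [s [h1 h2 ->]]]]|i j [cij _]].
  by exists i, j, s; split=> //; exact: conn_child_cadet.
move=> /point_marksP[i' [j' [s' [cij' c' e]]]].
have ji : j != i by rewrite eq_sym (child_neq cij).
have [[e1 e2]|[e1 e2]] := set2_eq ji e; subst i' j'.
  have := congr1 size (child_path cij); have := congr1 size (child_path cij').
  by rewrite !size_rcons; clear; lia.
have yij := child_conn cij c'; rewrite tchild in cij.
have /is_predP[/= lij _] := cij.
have m0 := range0 m.
have := @z_lt i j 0; rewrite eq_sym ji m0 => /(_ isT isT lij); rewrite yij /=.
by case; [lra|case].
Qed.

Let zrank i := #|[set j | z j < z i]%SET|.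

Lemma same_block_point a b : same_block point_marks a b = conn a b.
Proof.
apply/idP/idP.
  apply: connect_sub => c d /point_marksP[i [j [s [cij h e]]]].
  have [ecd|ncd] := eqVneq c d; first by rewrite ecd connect0.
  by have [[-> ->]|[-> ->]] := set2_eq ncd e; rewrite // connect_eq_edge_sym.
have zrank_lt i j : z i < z j -> (zrank i < zrank j)%N.
  move=> h; apply: proper_card; apply/properP; split.
    by apply/fintype.subsetP => k; rewrite !inE => /lt_trans; apply.
  by exists i; rewrite !inE ?ltxx.
have [N] := ubnP (zrank a + zrank b); elim: N a b => // N IH a b hN.
wlog lab : a b hN / z a < z b => [wl|] cab.
  case: (ltrgtP (z a) (z b)) => h; first exact: wl.
    by rewrite same_block_sym; apply: wl => //; rewrite 1?addnC // connect_eq_edge_sym.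
  by rewrite (z_inj zgen h); exact: connect0.
have [j [s [pj _ cbj]]] := pred_in_block cab lab.
apply: (@same_block_trans _ _ j).
  apply: IH; last exact: connect_trans cab cbj.
  by have := zrank_lt _ _ (is_pred_lt pj); move: hN => /=; clear; lia.
rewrite same_block_sym; apply: connect1; apply/point_marksP; exists b, j, s.
by rewrite tchild.
Qed.

Lemma point_drift a b : conn a b ->
  y ord0 a - y ord0 b = ((drift t a)%:Z - (drift t b)%:Z)%:~R.
Proof.
rewrite -same_block_point => ab; rewrite rmorphB /= -!pmulrn.
apply: (marked_edges_diff point_marked_tree _ ab) => i j s h cij.
rewrite (child_conn cij); first by ring.
by rewrite -same_block_point; exact: connect1.
Qed.

Lemma point_connected : arr_connected A t point_marks.
Proof.
move=> i a b; have inB c : (c \in block t point_marks i) = conn i c.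
  by rewrite -same_block_point inE; apply/asboolP/idP => /(same_blockP point_marked_tree).
rewrite !inB => ia ib; have ab : conn a b.
  by apply: connect_trans ib; rewrite connect_eq_edge_sym.
apply: connect_within ab => c d ac cd; rewrite !inB.
have ic := connect_trans ia ac; rewrite ic (connect_trans ic (connect1 cd)) /=.
case/asboolP: (cd) => s [As e]; have [-> _] := hyperplane_catalan (hA As).
rewrite /=; apply/asboolP; rewrite /drift_hyperplane.
suff -> : (drift t c)%:Z - (drift t d)%:Z = s by [].
by apply: (@intr_inj R); rewrite -e; symmetry; apply: point_drift; exact: connect1.
Qed.

Lemma point_sg a b (s : int) : a != b -> - m%:Z <= s <= m%:Z ->
  Num.sg (tree_point R t point_marks ord0 a - tree_point R t point_marks ord0 b - s%:~R)
  = Num.sg (y ord0 a - y ord0 b - s%:~R).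
Proof.
have mt := point_marked_tree.
move=> ab sm; have [sab|nab] := boolP (same_block point_marks a b).
  by rewrite (tree_point_same R mt sab) -point_drift // -same_block_point.
have key c d (u : nat) : c != d -> ~~ same_block point_marks c d -> (u <= m)%N ->
  Num.sg (tree_point R t point_marks ord0 c - tree_point R t point_marks ord0 d - u%:~R)
  = Num.sg (y ord0 c - y ord0 d - u%:~R).
  move=> cd ncd um; have uo : (u < m.+1)%N by [].
  have := prec_child_point R mt (Ordinal uo) ncd; rewrite tprec //= -!pmulrn => h.
  have Xn : tree_point R t point_marks ord0 c - tree_point R t point_marks ord0 d != u%:R.
    by apply/negP => /eqP /(@tree_point_int _ _ _ _ _ mt c d u)[sb]; rewrite sb in ncd.
  have yn : y ord0 c - y ord0 d != u%:R.
    by apply/negP => /eqP /(@ygen c d u); rewrite -same_block_point (negbTE ncd).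
  have uZ := range_nat um.
  have [zn zl] := zP cd uZ; rewrite -!pmulrn in zn zl.
  have : (y ord0 d + u%:R == y ord0 c) = false.
    by apply/negbTE; apply: contra yn => /eqP <-; apply/eqP; ring.
  move=> ye; rewrite ye orbF in zl.
  case: (ltrgtP (z c) (z d + u%:R)) => hz; last by rewrite hz eqxx in zn.
    rewrite !ltr0_sg ?subr_lt0 //; last by rewrite -h.
    rewrite lt_neqAle yn /=; move: zl; rewrite ltNge (ltW hz) /=.
    by move/esym/negbT; rewrite -leNgt; lra.
  rewrite !gtr0_sg ?subr_gt0 //; first by move: zl; rewrite hz; lra.
  rewrite lt_neqAle eq_sym Xn /=; move: h; rewrite ltNge (ltW hz) /=.
  by move/esym/negbT; rewrite -leNgt.
case: s sm => u; first by move=> sm; apply: key => //; move: sm; clear; lia.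
rewrite NegzE => sm; rewrite !sg_swap; congr (- _); apply: key; rewrite 1?eq_sym 1?same_block_sym //.
by move: sm; clear; lia.
Qed.

End MarkedTreeOfPoint.

Lemma marked_tree_of_point (R : realType) (m n : nat) (A : set (set 'rV[R]_n)) (y : 'rV[R]_n) :
  A `<=` @catalan R n m -> generic A y ->
  exists (t : tree m n) (mu : edges n), [/\ is_marked_tree t mu, arr_connected A t mu &
    forall (a b : 'I_n) (s : int), a != b -> - m%:Z <= s <= m%:Z ->
      Num.sg (tree_point R t mu ord0 a - tree_point R t mu ord0 b - s%:~R)
      = Num.sg (y ord0 a - y ord0 b - s%:~R)].
Proof.
move=> hA ygen; have [z zP] := tie_break m y.
have zgen (a b : 'I_n) (s : int) : a != b -> - m%:Z <= s <= m%:Z -> z b + s%:~R != z a.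
  by move=> ab sm; case: (zP a b s ab sm).
have [t [tT tchild tprec]] := tree_of_point zgen.
exists t, (point_marks A y t); split.
- exact: (point_marked_tree hA ygen zP).
- exact: (point_connected hA ygen zP).
- exact: (point_sg hA ygen zP).
Qed.

(* The potential that decreases when a block is pushed down. *)
Definition inversions (R : realType) (m n : nat) (x : 'rV[R]_n) : {set 'I_n * 'I_n * 'I_m.+1} :=
  [set q : 'I_n * 'I_n * 'I_m.+1 | ((0 < q.2)%N || (q.1.2 < q.1.1)%N) && (0 < x ord0 q.1.1 - x ord0 q.1.2 - (q.2 : nat)%:~R)]%SET.

(** * Pushing a block just below the block of its parent *)

Section Shift.
Variables (R : realType) (m n : nat) (A : set (set 'rV[R]_n)).
Hypothesis hA : A `<=` @catalan R n m.
Variables (t : tree m n) (mu : edges n).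
Hypothesis mt : is_marked_tree t mu.
Hypothesis conn : arr_connected A t mu.
Variables (i j : 'I_n) (s : 'I_m.+1).
Hypotheses (cad : is_cadet t i j s) (unmarked : [set i; j]%SET \notin mu).
Hypothesis not_default : ~ (s = ord0 /\ (i < j)%N).
Hypothesis unrelated : forall i' j', same_block mu i' i -> same_block mu j' j ->
  ~ A (drift_hyperplane t i' j').
Implicit Types (a b c k : 'I_n).
Local Notation P := (node_path t).
Local Notation X := (tree_point R t mu).
Local Notation off := (offset R t mu).

Let cij : is_child t i j s. Proof. by case: cad. Qed.

Let nij : ~~ same_block mu i j.
Proof. by apply: contra unmarked; rewrite same_block_sym; apply: (marked_child mt cij). Qed.

Let i_top : ~~ marked t mu i.
Proof.
apply: contra unmarked => /fintype.existsP[j' /fintype.existsP[s' /andP[cij' h]]].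
by have [->] := child_parent_inj mt cij cij'.
Qed.

Let j_last k (u : 'I_m.+1) : is_child t k j u -> [set k; j]%SET \notin mu.
Proof.
move=> ck; apply/negP => mk.
have us := cadet_max mt cad ck; have su := cadet_max mt (marked_child_cadet mt ck mk) cij.
have e : u = s by apply: val_inj; apply/eqP; rewrite eqn_leq us.
have ki : k = i.
  by case: mt => tT _ _; apply: (node_path_inj tT); rewrite (child_path ck) (child_path cij) e.
by move: unmarked; rewrite -ki mk.
Qed.

Let pji : prefix (P j) (P i).
Proof. by rewrite (child_path cij) prefix_rcons. Qed.

Let off_ji : off j < off i.
Proof. by apply: offset_prefix_lt => //; rewrite same_block_sym. Qed.

Let drift_ij : drift t i = (drift t j + s)%N.
Proof. by rewrite /drift (child_path cij) vdrift_rcons. Qed.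

Let block_i_ge b : same_block mu i b ->
  (drift t i < drift t b)%N || (drift t i == drift t b) && (i <= b)%N.
Proof. by move=> ib; rewrite -(block_prefixE mt ib); exact: (unmarked_top mt). Qed.

Let block_j_le a : same_block mu j a ->
  (drift t a < drift t j)%N || (drift t a == drift t j) && (a <= j)%N.
Proof.
rewrite same_block_sym => aj; rewrite -(block_prefixE mt aj).
exact: (block_last mt j_last).
Qed.

(** No other block has its offset between those of [j] and [i]: as [i] is the last non-leaf child of
    [j], every node strictly below [j] has offset at least that of [i], and a branching above [j]
    compares the same way with both. *)
Lemma cadet_between b : off j <= off b -> off b < off i -> same_block mu j b.
Proof.
move=> jb bi; have ePi := child_path cij.
case: (vertex_splitP (P b) (P j)) => [h|u w e|p u v w w' eb ej uv].
- have : off b = off j by apply/eqP; rewrite eq_le jb andbT; exact: offset_prefix.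
  by move/(offset_inj mt); rewrite same_block_sym.
- have [k ek] : exists k, P k = rcons (P j) u.
    by case: mt => tT _ _; apply: (node_path_prefix tT (i := b)); rewrite e -cat_rcons prefix_prefix.
  have ck : is_child t k j u by rewrite /is_child ek.
  have := cadet_max mt cad ck; rewrite leq_eqVlt => /orP[/eqP/val_inj us|us].
    suff : off i <= off b by rewrite leNgt bi.
    by apply: offset_prefix; rewrite ePi -us e -cat_rcons prefix_prefix.
  have := offset_div R mt (_ : P i = P j ++ s :: [::]) e us.
  by rewrite cats1 => /(_ ePi); rewrite ltNge (ltW bi).
- case: (ltngtP u v) => h; last by rewrite (val_inj h) eqxx in uv.
    have := offset_div R mt (_ : P i = p ++ v :: rcons w' s) eb h.
    by rewrite ePi ej rcons_cat => /(_ erefl); rewrite ltNge (ltW bi).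
  by have := offset_div R mt eb ej h; rewrite ltNge jb.
Qed.

(** The new offset may be negative, so the second bound is what keeps offset differences below 1 in
    absolute value, as [sg_int_frac] requires. *)
Lemma exists_shift : exists2 eps : R, 0 < eps &
  (forall b, off b < off j -> off b < off j - eps) /\ (forall b, off b - (off j - eps) < 1).
Proof.
apply: for_small_ex; apply: for_small_and.
  apply: for_small_fin => b; case: (ltP (off b) (off j)) => h; last first.
    by exists 1 => // e _ h'.
  by apply: for_small_sub (for_small_lt 1 h) _ => e _; lra.
apply: for_small_fin => b; have h : off b - off j < 1.
  by have := offset_diff R t mu b j; move=> /andP[].
by apply: for_small_sub (for_small_lt 1 h) _ => e _; lra.
Qed.

(** Only comparisons between the blocks of [i] and [j] change, and no hyperplane of [A] sees them.
    The triple [(i, j, s)] stops being an inversion. *)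
Lemma shift_block : exists y, [/\ cell A X y, generic A y &
  inversions m y \proper inversions m X].
Proof.
have [eps e0 [hlow h1]] := exists_shift.
pose o := off j - eps; have oj : o < off j by rewrite /o; lra.
pose off' b := if same_block mu i b then o else off b.
pose y : 'rV[R]_n := \row_b ((drift t b)%:R + off' b).
have frac a b : -1 < off' a - off' b < 1.
  have := offset_diff R t mu a b; have := h1 a; have := h1 b.
  have := offset_ge0 R t mu a; have := offset_ge0 R t mu b; have := offset_lt1 R t mu j.
  rewrite /off' -/o; case: ifP => _; case: ifP => _ // *; apply/andP; split; lra.
have ysg a b (r : int) : Num.sg (y ord0 a - y ord0 b - r%:~R) =
    if (drift t a)%:Z - (drift t b)%:Z - r == 0 then Num.sg (off' a - off' b)
    else Num.sg (((drift t a)%:Z - (drift t b)%:Z - r)%:~R : R).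
  rewrite -sg_int_frac; last exact: frac.
  by rewrite !mxE !rmorphB /= -!pmulrn; congr Num.sg; ring.
have half a b : same_block mu i a -> ~~ same_block mu i b -> ~~ same_block mu j b ->
    Num.sg (o - off b) = Num.sg (off a - off b).
  move=> ia nib njb; rewrite -(offset_same R mt ia).
  case: (ltrgtP (off b) (off i)) => h.
  - have bj : off b < off j.
      by rewrite ltNge; apply: contra njb => jb; exact: cadet_between.
    by rewrite !gtr0_sg ?subr_gt0 //; exact: hlow.
  - by rewrite !ltr0_sg ?subr_lt0 //; exact: lt_trans (lt_trans oj off_ji) h.
  - by case/negP: nib; rewrite same_block_sym; exact: (offset_inj mt h).
have offsg a b : ~~ (same_block mu i a && same_block mu j b) ->
    ~~ (same_block mu j a && same_block mu i b) ->
    Num.sg (off' a - off' b) = Num.sg (off a - off b).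
  rewrite /off'; case ia: (same_block mu i a); case ib: (same_block mu i b) => //=.
  - by rewrite -(offset_same R mt ia) -(offset_same R mt ib) !subrr.
  - by move=> njb _; apply: half; rewrite ?ib.
  - rewrite andbT => _ nja; apply: oppr_inj; rewrite -!sgrN [- (off a - o)]opprB.
    by rewrite [- (off a - off b)]opprB; apply: half; rewrite ?ia.
have off'_same a b : same_block mu a b -> off' a = off' b.
  move=> ab; rewrite /off' (offset_same R mt ab); suff -> : same_block mu i a = same_block mu i b by [].
  apply/idP/idP => h; first exact: same_block_trans h ab.
  by apply: same_block_trans h _; rewrite same_block_sym.
exists y; split.
- move=> a b r Aab; rewrite ysg tree_point_sg; case: eqP => // e.
  have er : r = (drift t a)%:Z - (drift t b)%:Z by move: e; clear; lia.
  apply: offsg; apply/negP => /andP[h h'].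
    case: (@unrelated a b); rewrite 1?same_block_sym // /drift_hyperplane -er //.
  case: (@unrelated b a); rewrite 1?same_block_sym // /drift_hyperplane hyperplane_sym.
  by rewrite opprB -er.
- move=> a b r e; have := ysg a b r; rewrite e subrr sgr0; case: ifP => [_|ne]; last first.
    by move/esym/eqP; rewrite sgr_eq0 intr_eq0 ne.
  move/esym/eqP; rewrite sgr_eq0 subr_eq0 => /eqP eo.
  have nin c d : same_block mu i c -> ~~ same_block mu i d -> off' c <> off' d.
    move=> ic /negbTE nid; rewrite /off' ic nid => eod.
    by have := hlow d; rewrite -eod -/o ltxx => /(_ oj).
  have ab : same_block mu a b.
    case ia: (same_block mu i a); case ib: (same_block mu i b).
    + by apply: same_block_trans ib; rewrite same_block_sym.
    + by case: (nin a b); rewrite ?ib.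
    + by case: (nin b a); rewrite ?ia.
    + by move: eo; rewrite /off' ia ib => /(offset_inj mt).
  apply: connect_sub (arr_connectedE mt conn ab) => c d /and3P[/asboolP Acd cd _].
  apply: connect1; apply/asboolP; exists ((drift t c)%:Z - (drift t d)%:Z); split=> //.
  by rewrite !mxE (off'_same _ _ cd) rmorphB /= -!pmulrn; ring.
apply/properP; split.
  apply/fintype.subsetP => -[[a b] r]; rewrite !inE /= => /andP[pos]; rewrite pos /=.
  rewrite -(sgr_gt0 (y ord0 a - _ - _)) -(sgr_gt0 (X ord0 a - _ - _)) ysg tree_point_sg; case: eqP => // e.
  rewrite !sgr_gt0; case ex1: (same_block mu i a && same_block mu j b).
    case/andP: ex1 => ia jb; rewrite /off' ia ifN; last first.
      by apply: contra nij => ib; apply: same_block_trans ib _; rewrite same_block_sym.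
    by rewrite -(offset_same R mt jb) subr_gt0 => h; have := lt_trans oj h; rewrite ltxx.
  case ex2: (same_block mu j a && same_block mu i b); last first.
    by rewrite -sgr_gt0 offsg ?ex1 ?ex2 // sgr_gt0.
  (* For a new inversion, [drift a <= drift j <= drift i <= drift b] and [drift a = drift b + r]
     force [r = s = 0]; then the labels satisfy [a <= j <= i <= b], against [b < a]. *)
  case/andP: ex2 => ja ib; exfalso.
  have := block_i_ge ib; have := block_j_le ja; move: pos e drift_ij.
  have s0 : (s : nat) = 0%N -> (j <= i)%N.
    move=> s0; rewrite leqNgt; apply/negP => h; apply: not_default; split=> //.
    exact: val_inj.
  have : nat_of_ord i <> j by move/val_inj => h; move: nij; rewrite h /same_block connect0.
  move: s0; clear; move=> s0 nij' pos e d h h'.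
  have z : (s : nat) = 0%N by lia.
  have := s0 z; lia.
exists (i, j, s); rewrite inE /=.
  apply/andP; split.
    case: (posnP s) => // s0; have := child_neq cij.
    case: (ltngtP i j) => // [h|/val_inj ->]; last by rewrite eqxx.
    by case: not_default; split=> //; exact: val_inj.
  rewrite -sgr_gt0 tree_point_sg drift_ij PoszD ifT; last by apply/eqP; ring.
  by rewrite sgr_gt0 subr_gt0.
apply/negP => /andP[_]; rewrite -sgr_gt0 ysg drift_ij PoszD ifT; last by apply/eqP; ring.
rewrite sgr_gt0 subr_gt0 /off' (negbTE nij) /same_block connect0 => h.
by have := lt_trans oj h; rewrite ltxx.
Qed.

End Shift.

Lemma exists_marked_tree (R : realType) (m n : nat) (A : set (set 'rV[R]_n)) (y : 'rV[R]_n) :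
  A `<=` @catalan R n m -> generic A y ->
  exists T : tree m n * edges n, marked_trees A T /\ cell A y (tree_point R T.1 T.2).
Proof.
move=> hA; have [N] := ubnP #|inversions m y|; elim: N y => // N IH y hN ygen.
have [t [mu [mt conn sg]]] := marked_tree_of_point hA ygen.
have cX : cell A y (tree_point R t mu).
  by move=> a b s As; have [ab sm] := hyperplane_catalan (hA _ As); apply: sg.
have [cad|ncad] := pselect (cadet_condition A t mu); first by exists (t, mu).
(* The tree point agrees with [y] on all Catalan hyperplanes, not only on those of [A], so
   rebuilding the tree leaves the potential unchanged. *)
have invE : inversions m (tree_point R t mu) = inversions m y.
  apply/finset.setP => -[[a b] s]; rewrite !inE /=; congr andb.
  have [->|ab] := eqVneq a b; first by rewrite !subrr.
  exact/sg_eq_gt0/sg/range_ord.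
have [y' [cy' gy' /proper_card]] : exists y', [/\ cell A (tree_point R t mu) y', generic A y' &
    inversions m y' \proper inversions m (tree_point R t mu)].
  move: ncad => /existsNP[i /existsNP[j /existsNP[s /not_implyP[cij /not_implyP[um nor]]]]].
  move/not_orP: nor => [nd nu].
  apply: (shift_block mt conn cij um nd) => i' j' ii' jj' Aij; apply: nu.
  by exists i', j'; split=> //; apply/(same_blockP mt).
rewrite invE => lt; have [T [hT cT]] := IH y' (leq_trans lt hN) gy'.
by exists T; split=> //; move: cT; rewrite (cell_eq cy') (cell_eq cX).
Qed.

Theorem theorem3p8 (R : realType) (m n : nat) (hm : (0 < m)%N) (hn : (0 < n)%N)
    (A : set (set 'rV[R]_n)) (hA : A `<=` @catalan R n m)
    (hst : strongly_transitive A) :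
  set_bij (@marked_trees m n R A) [set F | is_face A F] (@Phi m n R A) /\
  (forall T : tree m n * edges n,
     @marked_trees m n R A T -> has_codim (@Phi m n R A T) #|T.2|).
Proof.
have phiE (T : tree m n * edges n) : marked_trees A T -> Phi A T = cell A (tree_point R T.1 T.2).
  by case: T => t mu hT; case: (hT) => mt _ _; exact: Phi_cell.
split; last first.
  by move=> T hT; rewrite phiE //; case: hT => mt conn _; exact: tree_codim.
split.
- move=> T hT; rewrite /= phiE //; apply/(face_cellP _ hA).
  by exists (tree_point R T.1 T.2).
- move=> [t mu] [t' mu']; rewrite !inE => hT hT'; rewrite !phiE //= => e.
  by apply: (marked_trees_eq hst hT hT'); rewrite e.
- move=> F /(face_cellP _ hA)[x Fx ->].
  have [y cy gy] := exists_generic hA x.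
  have [T [hT cT]] := exists_marked_tree hA gy.
  by exists T => //; rewrite phiE // (cell_eq cT) (cell_eq cy).
Qed.
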